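(* For any fixed integer $k\ge 0$ there is a comparison-based deterministic RAM algorithm computing $F_k^{\boxplus n}$ with time $T$ and space $S$ satisfying $T\cdot S\in O(n^2\log^2 n)$, for all space bounds $S$ with $\log n\le S\le n$.
   Context: For a string $a$, $F_k(a)=\sum_i f_i^k$ where $f_i$ is the number of occurrences of symbol $i$ in $a$ and the sum ranges over symbols occurring in $a$ ($F_0$ is the number of distinct symbols). $F_k^{\boxplus n}$ maps $x=(x_1,\ldots,x_{2n-1})$ to $(F_k(x_i,\ldots,x_{i+n-1}))_{i=1}^n$. Comparison-based means the algorithm accesses input values only via comparisons between them. Input is read-only, output write-only, and neither counts toward space. *)

(* Defs.v *)
From HB Require Import structures.
From mathcomp Require Import all_boot all_order.

Set Implicit Arguments.
Unset Strict Implicit.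
Unset Printing Implicit Defensive.

(* The range of summation is the set of symbols occurring in [a], so the
   convention [0 ^ 0 = 1] plays no role and [freq_moment 0 a] is the number of
   distinct symbols of [a]. *)
Definition freq_moment (D : eqType) (k : nat) (a : seq D) : nat :=
  \sum_(s <- undup a) count_mem s a ^ k.

Definition sliding (D B : Type) (f : seq D -> B) (n : nat)
    (x : (n.*2.-1).-tuple D) : n.-tuple B :=
  [tuple f (take n (drop i x)) | i < n].

(* Deterministic word RAM.  The work memory is an array of words, addressed from
   0; below, M[a] is the content of word a.  The input x_0, x_1, ... is not part
   of the memory: its elements cannot be copied there, and the only instruction
   mentioning them is [InLt], which compares two of them.  The output is a
   sequence of words that can only be appended to. *)
Inductive binop := Add | Sub | Mul | Div.

Inductive instr :=
| Const (a v : nat)                (* M[a] := v *)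
| Arith (o : binop) (a b c : nat)  (* M[a] := M[b] o M[c] *)
| Fetch (a b : nat)                (* M[a] := M[M[b]] *)
| Store (a b : nat)                (* M[M[a]] := M[b] *)
| Lt (a b l : nat)                 (* if M[a] < M[b] goto l *)
| InLt (a b l : nat)               (* if x_M[a] < x_M[b] goto l *)
| Output (a : nat).                (* append M[a] to the output *)

Definition program := seq instr.

Record state := State { pc : nat; memory : seq nat; out : seq nat }.

Definition eval_binop (o : binop) : nat -> nat -> nat :=
  match o with Add => addn | Sub => subn | Mul => muln | Div => divn end.

Definition write (w : nat) (s : state) (a v : nat) : option state :=
  if (a < size (memory s)) && (v < 2 ^ w)
  then Some (State (pc s).+1 (set_nth 0 (memory s) a v) (out s)) else None.

Definition branch (s : state) (b : bool) (l : nat) : state :=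
  State (if b then l else (pc s).+1) (memory s) (out s).

(* One step with words of [w] bits.  The result is [None] when an address or an
   input index is out of range or when a result does not fit in a word (these
   are errors), and when [pc] is outside the program (the machine has halted,
   see [computes]). *)
Definition step (disp : Order.disp_t) (D : orderType disp) (P : program)
    (x : seq D) (w : nat) (s : state) : option state :=
  let M := onth (memory s) in
  match onth P (pc s) with
  | Some (Const a v) => write w s a v
  | Some (Arith o a b c) =>
      if (M b, M c) is (Some u, Some v) then write w s a (eval_binop o u v)
      else None
  | Some (Fetch a b) => if obind M (M b) is Some v then write w s a v else None
  | Some (Store a b) =>
      if (M a, M b) is (Some i, Some v) then write w s i v else None
  | Some (Lt a b l) =>
      if (M a, M b) is (Some u, Some v) then Some (branch s (u < v) l)
      else None
  | Some (InLt a b l) =>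
      if (obind (onth x) (M a), obind (onth x) (M b)) is (Some u, Some v)
      then Some (branch s (u < v)%O l) else None
  | Some (Output a) =>
      if M a is Some v then Some (State (pc s).+1 (memory s) (rcons (out s) v))
      else None
  | None => None
  end.

Definition run (disp : Order.disp_t) (D : orderType disp) (P : program)
    (x : seq D) (w t : nat) (s : state) : option state :=
  iter t (obind (step P x w)) (Some s).

(* The initial memory has [m] words when [1 < m]. *)
Definition init (m n S : nat) : state :=
  State 0 [:: n, S & nseq m.-2 0] [::].

(* With parameters [n] and [S], [P] maps the input [x] to the output [y] in at
   most [T] steps, without error, in a memory of [m] words of [w] bits each. *)
Definition computes (disp : Order.disp_t) (D : orderType disp) (P : program)
    (m w T n S : nat) (x : seq D) (y : seq nat) : Prop :=
  [/\ 1 < m, n < 2 ^ w, S < 2 ^ w &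
      exists t s, [/\ t <= T, run P x w t (init m n S) = Some s,
                      size P <= pc s & out s = y]].

(* The binary logarithm, rounded up: for natural numbers [S], the condition
   [lg n <= S] is exactly log_2 n <= S. *)
Definition lg (n : nat) : nat := up_log 2 n.

(* Main.v *)
(* Write F(t) for the moment of the window (x_{t-n}, ..., x_{t-1}), truncated on
   the left at x_0.  From F(t) to F(t+1) the symbol x_{t-n} leaves and x_t enters,
   so F changes by powers of the multiplicities of these two symbols only.  The
   steps are cut into blocks of about S / log n.  For a block, the indices of its
   departing and arriving symbols are sorted, and one scan of the current window
   with a binary search per element yields the multiplicities of these symbols,
   which are then maintained during the block.  A block costs O(n log n), which
   dominates its sorting in O(l log^2 l) for l = S / log n <= n / log n, and there
   are O(n log n / S) blocks.  The sort is a merge sort in which the new position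
   of an item is the sum of its ranks in the two halves, each found by binary
   search. *)

Require Import Defs.
From HB Require Import structures.
From mathcomp Require Import all_boot all_order.
From mathcomp Require Import zify.

Set Implicit Arguments.
Unset Strict Implicit.
Unset Printing Implicit Defensive.

Import Order.TTheory.

(** * A structured language compiled to the RAM *)

(** The algorithm is written in a small imperative language. The RAM matters only for the
    correctness of a compiler that counts steps exactly; everything else is a Hoare logic with time
    bounds. Since input elements cannot be copied, the arrays hold item numbers, and the input index
    is recomputed from them at every comparison. Equal symbols are ordered by item number: ranks are
    then distinct, so that writing each item at its rank is a permutation, whereas a search with
    tie-break 0 lands on the first item of a symbol, whose position names the counter shared by all
    items with that symbol. Truncating windows on the left avoids any initialization: the slide
    starts from the empty window with moment 0, and the first [n - 1] steps merely produce no
    output. Blocks have length about [S / log n] because each array entry occupies a word of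
    [O(log n)] bits. Natural subtraction truncates, so an update adds the new power before it
    subtracts the old one; a word must therefore hold a moment plus one power. *)

(* Memory layout: words below [nvar] hold the variables, those from [nvar] to
   [nreg - 1] are temporaries for expressions, and the entry [i] of array [k < 3]
   is the word [nreg + 3 * i + k]. *)
Definition nvar := 25.
Definition nreg := 33.

Inductive expr :=
| N (v : nat)
| V (x : nat)
| Op (o : binop) (e1 e2 : expr)
| Get (k : nat) (e : expr).

Inductive cond :=
| CLt (e1 e2 : expr)
| CIn (e1 e2 : expr).

Inductive com :=
| Skip
| Set_ (x : nat) (e : expr)
| Put (k : nat) (e1 e2 : expr)
| Out (e : expr)
| Seq (c1 c2 : com)
| If (b : cond) (c1 c2 : com)
| While (b : cond) (c : com).

Record store := Store_ {
  reg : nat -> nat;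
  arr : nat -> nat -> nat;
  log : seq nat }.

Fixpoint eval (s : store) (e : expr) : nat :=
  match e with
  | N v => v
  | V x => reg s x
  | Op o e1 e2 => eval_binop o (eval s e1) (eval s e2)
  | Get k e => arr s k (eval s e)
  end.

Definition set_reg (s : store) x v :=
  Store_ (fun y => if y == x then v else reg s y) (arr s) (log s).
Definition set_arr (s : store) k i v :=
  Store_ (reg s)
    (fun k' i' => if (k' == k) && (i' == i) then v else arr s k' i') (log s).
Definition emit (s : store) v := Store_ (reg s) (arr s) (rcons (log s) v).

Fixpoint esize (e : expr) : nat :=
  match e with
  | N _ => 1
  | V _ => 2
  | Op _ e1 e2 => esize e1 + esize e2 + 1
  | Get _ e => esize e + 5
  end.

Definition bsize (b : cond) : nat :=
  match b with CLt e1 e2 | CIn e1 e2 => esize e1 + esize e2 + 1 end.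

Fixpoint csize (c : com) : nat :=
  match c with
  | Skip => 0
  | Set_ _ e => esize e + 2
  | Put _ e1 e2 => esize e1 + 4 + esize e2 + 1
  | Out e => esize e + 1
  | Seq c1 c2 => csize c1 + csize c2
  | If b c1 c2 => bsize b + csize c2 + 3 + csize c1
  | While b c => bsize b + 3 + csize c + 3
  end.

(** The value is left in word [d], and only words from [d] on are used. The arrays are interleaved
    because their length depends on [n] and [S]: arrays laid out one after the other would have base
    addresses unknown at compile time. A variable is copied by adding it to 0. *)
Fixpoint compE (e : expr) (d : nat) : program :=
  match e with
  | N v => [:: Const d v]
  | V x => [:: Const d 0; Arith Add d d x]
  | Op o e1 e2 => compE e1 d ++ compE e2 d.+1 ++ [:: Arith o d d d.+1]
  | Get k e => compE e d ++ [:: Const d.+1 3; Arith Mul d d d.+1;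
      Const d.+1 (nreg + k); Arith Add d d d.+1; Fetch d d]
  end.

Definition compB (b : cond) (l : nat) : program :=
  match b with
  | CLt e1 e2 => compE e1 nvar ++ compE e2 nvar.+1 ++ [:: Lt nvar nvar.+1 l]
  | CIn e1 e2 => compE e1 nvar ++ compE e2 nvar.+1 ++ [:: InLt nvar nvar.+1 l]
  end.

Definition jump (l : nat) : program :=
  [:: Const nvar 0; Const nvar.+1 1; Lt nvar nvar.+1 l].

(** A branch is taken when its test holds, so the else-branch and the exit of a loop come right
    after the test. Jump targets can be computed in advance since [csize] does not depend on
    [off]. *)
Fixpoint compile (off : nat) (c : com) : program :=
  match c with
  | Skip => [::]
  | Set_ x e =>
      compE e nvar ++ [:: Const nvar.+1 0; Arith Add x nvar nvar.+1]
  | Put k e1 e2 =>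
      compE e1 nvar ++ [:: Const nvar.+1 3; Arith Mul nvar nvar nvar.+1;
        Const nvar.+1 (nreg + k); Arith Add nvar nvar nvar.+1] ++
      compE e2 nvar.+1 ++ [:: Store nvar nvar.+1]
  | Out e => compE e nvar ++ [:: Output nvar]
  | Seq c1 c2 => compile off c1 ++ compile (off + csize c1) c2
  | If b c1 c2 =>
      let l2 := off + bsize b in
      let l1 := l2 + csize c2 + 3 in
      compB b l1 ++ compile l2 c2 ++ jump (l1 + csize c1) ++ compile l1 c1
  | While b c =>
      let l := off + bsize b + 3 in
      compB b l ++ jump (l + csize c + 3) ++ compile l c ++ jump off
  end.

Lemma size_compE e d : size (compE e d) = esize e.
Proof.
elim: e d => //= [o e1 IH1 e2 IH2|k e IH] d; rewrite !size_cat /= ?IH1 ?IH2 ?IH; lia.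
Qed.

Lemma size_compB b l : size (compB b l) = bsize b.
Proof. by case: b => e1 e2; rewrite /= !size_cat !size_compE addnA. Qed.

Lemma size_compile c off : size (compile off c) = csize c.
Proof.
elim: c off => //= [x e|k e1 e2|e|c1 IH1 c2 IH2|b c1 IH1 c2 IH2|b c IH] off;
  by rewrite ?size_cat /= ?size_cat ?size_compE /= ?size_compB ?IH1 ?IH2 ?IH /=;
     lia.
Qed.

Fixpoint temps (e : expr) : nat :=
  match e with
  | N _ | V _ => 0
  | Op _ e1 e2 => maxn (temps e1) (temps e2).+1
  | Get _ e => maxn (temps e) 1
  end.

Fixpoint wfE (e : expr) : bool :=
  match e with
  | N _ => true
  | V x => x < nvar
  | Op _ e1 e2 => wfE e1 && wfE e2
  | Get k e => (k < 3) && wfE e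
  end.

Definition okE d e := wfE e && (d + temps e < nreg).

Definition okB b :=
  match b with CLt e1 e2 | CIn e1 e2 => okE nvar e1 && okE nvar.+1 e2 end.

Fixpoint ok (c : com) : bool :=
  match c with
  | Skip => true
  | Set_ x e => (x < nvar) && okE nvar e
  | Put k e1 e2 => [&& k < 3, okE nvar e1 & okE nvar.+1 e2]
  | Out e => okE nvar e
  | Seq c1 c2 => ok c1 && ok c2
  | If b c1 c2 => [&& okB b, ok c1 & ok c2]
  | While b c => okB b && ok c
  end.

(** * Correctness of the compiler, with exact step counts *)

Section Machine.

Variables (disp : Order.disp_t) (D : orderType disp).
Variables (x : seq D) (key : nat -> D) (w asz : nat).

Hypothesis keyP : forall i, i < size x -> onth x i = Some (key i).
Hypothesis fits : nreg + 3 * asz <= 2 ^ w.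

(** These conditions exclude every error of the machine. A variable needs none, because [rep] bounds
    all words of the memory. *)
Fixpoint safe (s : store) (e : expr) : Prop :=
  match e with
  | N v => v < 2 ^ w
  | V _ => True
  | Op o e1 e2 =>
      [/\ safe s e1, safe s e2 & eval_binop o (eval s e1) (eval s e2) < 2 ^ w]
  | Get k e => safe s e /\ eval s e < asz
  end.

Definition safeB (s : store) (b : cond) : Prop :=
  match b with
  | CLt e1 e2 => safe s e1 /\ safe s e2
  | CIn e1 e2 => [/\ safe s e1, safe s e2, eval s e1 < size x
                   & eval s e2 < size x]
  end.

Definition evalB (s : store) (b : cond) : bool :=
  match b with
  | CLt e1 e2 => eval s e1 < eval s e2
  | CIn e1 e2 => (key (eval s e1) < key (eval s e2))%O
  end.

(** The last index is the number of machine steps of the compiled code. The constant 3 is the length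
    of a [jump], paid after an else-branch, after a loop body and on leaving a loop. *)
Inductive exec : com -> store -> store -> nat -> Prop :=
| ESkip s : exec Skip s s 0
| ESet y e s : safe s e ->
    exec (Set_ y e) s (set_reg s y (eval s e)) (esize e + 2)
| EPut k e1 e2 s : safe s e1 -> safe s e2 -> eval s e1 < asz ->
    exec (Put k e1 e2) s (set_arr s k (eval s e1) (eval s e2))
      (esize e1 + 4 + esize e2 + 1)
| EOut e s : safe s e -> exec (Out e) s (emit s (eval s e)) (esize e + 1)
| ESeq c1 c2 s1 s2 s3 t1 t2 : exec c1 s1 s2 t1 -> exec c2 s2 s3 t2 ->
    exec (Seq c1 c2) s1 s3 (t1 + t2)
| EIfT b c1 c2 s s' t : safeB s b -> evalB s b -> exec c1 s s' t ->
    exec (If b c1 c2) s s' (bsize b + t)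
| EIfF b c1 c2 s s' t : safeB s b -> ~~ evalB s b -> exec c2 s s' t ->
    exec (If b c1 c2) s s' (bsize b + t + 3)
| EWhileT b c s1 s2 s3 t1 t2 : safeB s1 b -> evalB s1 b -> exec c s1 s2 t1 ->
    exec (While b c) s2 s3 t2 ->
    exec (While b c) s1 s3 (bsize b + t1 + 3 + t2)
| EWhileF b c s : safeB s b -> ~~ evalB s b ->
    exec (While b c) s s (bsize b + 3).

Variable P : program.

Definition code_at off (c : program) :=
  forall i, i < size c -> onth P (off + i) = onth c i.

Lemma code_cat off c1 c2 : code_at off (c1 ++ c2) ->
  code_at off c1 /\ code_at (off + size c1) c2.
Proof.
move=> H; split=> i Hi.
  by rewrite H ?size_cat ?onth_cat ?Hi // ltn_addr.
by rewrite -addnA H ?size_cat ?ltn_add2l // onth_cat ltnNge leq_addr /= addKn.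
Qed.

Lemma code_cons off i c : code_at off (i :: c) ->
  onth P off = Some i /\ code_at off.+1 c.
Proof.
move=> H; split; first by rewrite -[off]addn0 H.
by move=> j Hj; rewrite addSnnS H.
Qed.

Definition rep off (s : store) (q : state) :=
  [/\ pc q = off, out q = log s, size (memory q) = nreg + 3 * asz,
      forall y, y < nvar -> nth 0 (memory q) y = reg s y
    & (forall k i, k < 3 -> i < asz ->
        nth 0 (memory q) (nreg + 3 * i + k) = arr s k i) /\
      forall a, nth 0 (memory q) a < 2 ^ w].

Definition steps t q q' := run P x w t q = Some q'.

Lemma steps_add t1 t2 q1 q2 q3 :
  steps t1 q1 q2 -> steps t2 q2 q3 -> steps (t1 + t2) q1 q3.
Proof. by rewrite /steps /run => H1 H2; rewrite addnC iterD H1. Qed.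

Lemma steps_step q q' : step P x w q = Some q' -> steps 1 q q'.
Proof. by []. Qed.

Lemma onth_mem off s q a : rep off s q -> a < nreg + 3 * asz ->
  onth (memory q) a = Some (nth 0 (memory q) a).
Proof.
case=> _ _ sz _ _ Ha; have: onth (memory q) a by rewrite onthTE sz.
by case E: (onth _ _) => [v|//] _; rewrite (onth_nth _ _ _ _ E).
Qed.

Lemma rep_temp off s q a v : rep off s q -> nvar <= a < nreg -> v < 2 ^ w ->
  rep off.+1 s (State off.+1 (set_nth 0 (memory q) a v) (out q)).
Proof.
case=> Hpc Ho Hs Hr [Ha Hb] /andP[H1 H2] Hv; split=> //=.
- by rewrite size_set_nth Hs; apply/maxn_idPr; lia.
- by move=> y Hy; rewrite nth_set_nth /= Hr //; case: eqP => // E; lia.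
split=> [k i Hk Hi|b]; rewrite nth_set_nth /=.
  by rewrite Ha //; case: eqP => // E; lia.
by case: eqP.
Qed.

Lemma write_temp off s q a v : rep off s q -> nvar <= a < nreg -> v < 2 ^ w ->
  write w q a v = Some (State off.+1 (set_nth 0 (memory q) a v) (out q)).
Proof.
case=> Hpc _ Hs _ _ /andP[H1 H2] Hv; rewrite /write Hs Hv Hpc.
by rewrite ltn_addr.
Qed.

Lemma reg_lt a : a < nreg -> a < nreg + 3 * asz.
Proof. lia. Qed.

Lemma run_const off s q a v : onth P off = Some (Const a v) ->
  rep off s q -> nvar <= a < nreg -> v < 2 ^ w ->
  exists q', [/\ steps 1 q q', rep off.+1 s q' &
    forall b, nth 0 (memory q') b = if b == a then v else nth 0 (memory q) b].
Proof.
move=> Hc Hr Ha Hv; have [Hpc _ _ _ _] := Hr.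
eexists; split; [|exact: (rep_temp Hr Ha Hv)|by move=> b; rewrite /= nth_set_nth].
by apply: steps_step; rewrite /step Hpc Hc; apply: (write_temp Hr).
Qed.

Lemma run_arith off s q o a b c : onth P off = Some (Arith o a b c) ->
  rep off s q -> nvar <= a < nreg -> b < nreg -> c < nreg ->
  let v := eval_binop o (nth 0 (memory q) b) (nth 0 (memory q) c) in
  v < 2 ^ w ->
  exists q', [/\ steps 1 q q', rep off.+1 s q' &
    forall b, nth 0 (memory q') b = if b == a then v else nth 0 (memory q) b].
Proof.
move=> Hc Hr Ha Hb Hcc v Hv; have [Hpc _ _ _ _] := Hr.
eexists; split; [|exact: (rep_temp Hr Ha Hv)|by move=> d; rewrite /= nth_set_nth].
apply: steps_step; rewrite /step Hpc Hc !(onth_mem Hr) ?reg_lt //.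
exact: (write_temp Hr).
Qed.

Lemma run_address off s q d k i :
  code_at off [:: Const d.+1 3; Arith Mul d d d.+1;
                  Const d.+1 (nreg + k); Arith Add d d d.+1] ->
  rep off s q -> nvar <= d -> d.+1 < nreg -> k < 3 -> i < asz ->
  nth 0 (memory q) d = i ->
  exists q', [/\ steps 4 q q', rep (off + 4) s q',
    nth 0 (memory q') d = nreg + 3 * i + k &
    forall b, b < d -> nth 0 (memory q') b = nth 0 (memory q) b].
Proof.
move=> /code_cons[c1 /code_cons[c2 /code_cons[c3 /code_cons[c4 _]]]].
move=> Hr Hd1 Hd2 Hk Hi Hq.
have [|| q1 [s1 r1 m1]] := run_const c1 Hr; [lia|by move: fits; rewrite /nreg; lia|].
have En : (d == d.+1) = false by lia.
have [|||| q2 [s2 r2 m2]] := run_arith c2 r1; try lia.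
  by rewrite /= !m1 eqxx En Hq; move: fits; rewrite /nreg; lia.
have [|| q3 [s3 r3 m3]] := run_const c3 r2; try lia.
have [|||| q4 [s4 r4 m4]] := run_arith c4 r3; try lia.
  rewrite /= !m3 eqxx En m2 eqxx /= !m1 eqxx En Hq.
  by move: fits; rewrite /nreg; lia.
exists q4; split.
- exact: (steps_add s1 (steps_add s2 (steps_add s3 s4))).
- by rewrite addn4.
- by rewrite m4 eqxx /= !m3 eqxx En m2 eqxx /= !m1 eqxx En Hq; lia.
move=> b Hb; have [E1 E2] : (b == d) = false /\ (b == d.+1) = false by lia.
by rewrite m4 E1 m3 E2 m2 E1 m1 E2.
Qed.

(** The last clause carries the induction: the left operand of an [Op] survives in word [d] while
    the right one is evaluated from [d.+1] on. *)
Lemma run_expr e d off s q : code_at off (compE e d) -> rep off s q ->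
  nvar <= d -> okE d e -> safe s e ->
  exists q', [/\ steps (esize e) q q', rep (off + esize e) s q',
    nth 0 (memory q') d = eval s e &
    forall b, b < d -> nth 0 (memory q') b = nth 0 (memory q) b].
Proof.
rewrite /okE; elim: e d off q => [v|y|o e1 IH1 e2 IH2|k e IH] d off q /=.
- move=> /code_cons[c _] Hr Hd /= Ht Hv.
  have [|//|q' [s1 r1 m1]] := run_const c Hr; first by lia.
  exists q'; split=> //; [by rewrite addn1|by rewrite m1 eqxx|].
  by move=> b Hb; rewrite m1 ltn_eqF.
- move=> /code_cons[c1 /code_cons[c2 _]] Hr Hd /andP[Hy Ht] _.
  have [||q1 [s1 r1 m1]] := run_const c1 Hr; [lia|lia|].
  have [_ _ _ Hm _] := Hr.
  have Ey : (y == d) = false by lia.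
  have Ev : nth 0 (memory q1) d + nth 0 (memory q1) y = reg s y.
    by rewrite !m1 eqxx Ey Hm.
  have [||||q2 [s2 r2 m2]] := run_arith c2 r1; try by lia.
    by rewrite /= Ev -Hm //; have [_ _ _ _ [_]] := Hr.
  exists q2; split; [exact: (steps_add s1 s2)|by rewrite addn2| |].
    by rewrite m2 eqxx /= Ev.
  by move=> b Hb; rewrite m2 ltn_eqF // m1 ltn_eqF.
- move=> /code_cat[c1 /code_cat[c2 c3]] Hr Hd /andP[/andP[w1 w2] Ht].
  move=> [h1 h2 h3].
  have [||q1 [s1 r1 v1 m1]] := IH1 _ _ _ c1 Hr Hd; [by lia|by []|].
  rewrite size_compE in c2 c3.
  have [|||q2 [s2 r2 v2 m2]] := IH2 _ _ _ c2 r1; [by lia|by lia|by []|].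
  rewrite size_compE in c3; case/code_cons: c3 => c3 _.
  have Ev : nth 0 (memory q2) d = eval s e1 by rewrite m2.
  have [||||q3 [s3 r3 m3]] := run_arith c3 r2; try by lia.
    by rewrite v2 Ev.
  exists q3; split.
  + by rewrite -addnA; apply: (steps_add s1 (steps_add s2 s3)).
  + by rewrite addn1 addnS addnA.
  + by rewrite m3 eqxx v2 Ev.
  by move=> b Hb; rewrite m3 ltn_eqF // m2 ?m1 // ltnS ltnW.
move=> /code_cat[c1 c2] Hr Hd /andP[/andP[w1 w2] Ht] [h1 h2].
have [||q1 [s1 r1 v1 m1]] := IH _ _ _ c1 Hr Hd; [by lia|by []|].
rewrite size_compE in c2.
case/(@code_cat _ [:: _; _; _; _] [:: _]): c2 => c2 /= /code_cons[c3 _].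
have [|q2 [s2 r2 v2 m2]] := run_address c2 r1 Hd _ w1 h2 v1; first by lia.
have [Hpc _ _ _ [Ha Hb]] := r2.
have Ev : arr s k (eval s e) < 2 ^ w by rewrite -Ha.
have Hd' : nvar <= d < nreg by lia.
have r3 := rep_temp r2 Hd' Ev.
eexists; split.
- rewrite -[5]/(4 + 1); apply: (steps_add s1 (steps_add s2 (steps_step _))).
  rewrite /step Hpc c3 (onth_mem r2) ?reg_lt //=; last by lia.
  rewrite v2 (onth_mem r2); last by lia.
  rewrite Ha //; exact: (write_temp r2).
- by rewrite -[5]/(4 + 1) !addnA addn1.
- by rewrite /= nth_set_nth /= eqxx.
by move=> b Hlt; rewrite /= nth_set_nth /= ltn_eqF // m2 // m1.
Qed.

Lemma rep_branch off s q a : rep off s q -> rep a s (State a (memory q) (out q)).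
Proof. by case. Qed.

Lemma run_jump off s q l : code_at off (jump l) -> rep off s q ->
  exists q', steps 3 q q' /\ rep l s q'.
Proof.
move=> /code_cons[c1 /code_cons[c2 /code_cons[c3 _]]] Hr.
have fits' := fits; rewrite /nreg in fits'.
have [//||q1 [s1 r1 m1]] := run_const c1 Hr; first lia.
have [//||q2 [s2 r2 m2]] := run_const c2 r1; first lia.
have [Hpc _ _ _ _] := r2.
eexists; split; last exact: (rep_branch l r2).
apply: (steps_add s1 (steps_add s2 (steps_step _))).
by rewrite /step Hpc c3 !(onth_mem r2) // m2 m1 m2.
Qed.

Lemma run_cond b off s q l : code_at off (compB b l) -> rep off s q ->
  okB b -> safeB s b ->
  exists q', steps (bsize b) q q' /\
    rep (if evalB s b then l else off + bsize b) s q'.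
Proof.
case: b => e1 e2 /= /code_cat[c1 /code_cat[c2 /code_cons[c3 _]]] Hr
  /andP[o1 o2].
- case=> h1 h2.
  have [//|q1 [s1 r1 v1 m1]] := run_expr c1 Hr _ o1 h1.
  rewrite !size_compE in c2 c3.
  have [//|q2 [s2 r2 v2 m2]] := run_expr c2 r1 _ o2 h2.
  have [Hpc _ _ _ _] := r2.
  eexists; split; last exact: (rep_branch _ r2).
  rewrite -addnA; apply: (steps_add s1 (steps_add s2 (steps_step _))).
  rewrite /step Hpc c3 !(onth_mem r2) // v2 m2 // v1 /branch Hpc.
  by rewrite /= addn1 !addnS !addnA.
case=> h1 h2 h3 h4.
have [//|q1 [s1 r1 v1 m1]] := run_expr c1 Hr _ o1 h1.
rewrite !size_compE in c2 c3.
have [//|q2 [s2 r2 v2 m2]] := run_expr c2 r1 _ o2 h2.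
have [Hpc _ _ _ _] := r2.
eexists; split; last exact: (rep_branch _ r2).
rewrite -addnA; apply: (steps_add s1 (steps_add s2 (steps_step _))).
rewrite /step Hpc c3 !(onth_mem r2) //= v2 m2 // v1 /branch Hpc.
by rewrite !keyP // addn1 !addnS !addnA.
Qed.

Opaque jump.

(** The induction is on the execution, not on the command: an iteration ends with a jump back to
    [off], where the remaining iterations run the same code. *)
Lemma run_com c s s' t : exec c s s' t -> forall off q,
  code_at off (compile off c) -> ok c -> rep off s q ->
  exists q', steps t q q' /\ rep (off + csize c) s' q'.
Proof.
elim=> {c s s' t} /=.
- by move=> s off q _ _ Hr; exists q; rewrite addn0.
- move=> y e s h off q /code_cat[c1]; rewrite size_compE.
  move=> /code_cons[c2 /code_cons[c3 _]] /andP[Hy Ho] Hr.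
  have [//|q1 [s1 r1 v1 m1]] := run_expr c1 Hr _ Ho h.
  have [//||q2 [s2 r2 m2]] := run_const c2 r1 _; first by lia.
  have [Hpc Hou Hs Hm [Ha Hb]] := r2.
  have E1 : nth 0 (memory q2) nvar = eval s e by rewrite m2.
  have E2 : nth 0 (memory q2) nvar.+1 = 0 by rewrite m2.
  have Hv : eval s e < 2 ^ w by rewrite -E1.
  have Hy' : y < nreg + 3 * asz by rewrite /nvar /nreg in Hy *; lia.
  exists (State (pc q2).+1 (set_nth 0 (memory q2) y (eval s e)) (out q2)); split.
    rewrite -[2]/(1 + 1); apply: (steps_add s1 (steps_add s2 (steps_step _))).
    rewrite /step Hpc c3 !(onth_mem r2) // E1 E2 /= addn0.
    by rewrite /write Hv Hs Hy' Hpc.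
  split=> //=; first by rewrite Hpc addn2 !addnS.
  - by rewrite size_set_nth Hs; apply/maxn_idPr.
  - by move=> z Hz; rewrite nth_set_nth /=; case: eqP => // _; apply: Hm.
  split=> [k i Hk Hi|b]; rewrite nth_set_nth /=; case: eqP => // E.
  + by rewrite /nvar /nreg in Hy E *; lia.
  + exact: Ha.
- move=> k e1 e2 s h1 h2 h3 off q /code_cat[c1]; rewrite size_compE.
  move=> /(@code_cat _ [:: _; _; _; _])[c2 /code_cat[c3]] /=.
  rewrite size_compE => /code_cons[c4 _] /and3P[Hk o1 o2] Hr.
  have [//|q1 [s1 r1 v1 m1]] := run_expr c1 Hr _ o1 h1.
  have [//|//|q2 [s2 r2 v2 m2]] := run_address c2 r1 _ _ Hk h3 v1.
  have [//|q3 [s3 r3 v3 m3]] := run_expr c3 r2 _ o2 h2.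
  have [Hpc Hou Hs Hm [Ha Hb]] := r3.
  have E1 : nth 0 (memory q3) nvar = nreg + 3 * eval s e1 + k by rewrite m3.
  have Hv : eval s e2 < 2 ^ w by rewrite -v3.
  have Hl : nreg + 3 * eval s e1 + k < nreg + 3 * asz by lia.
  exists (State (pc q3).+1 (set_nth 0 (memory q3) (nreg + 3 * eval s e1 + k)
    (eval s e2)) (out q3)); split.
    have -> : esize e1 + 4 + esize e2 + 1 = esize e1 + (4 + (esize e2 + 1)) by lia.
    apply: (steps_add s1 (steps_add s2 (steps_add s3 (steps_step _)))).
    rewrite /step Hpc c4 !(onth_mem r3) // E1 v3.
    by rewrite /write Hv Hs Hl Hpc.
  split=> //=; first by rewrite Hpc addn1 !addnS !addnA.
  - by rewrite size_set_nth Hs; apply/maxn_idPr.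
  - move=> z Hz; rewrite nth_set_nth /=; case: eqP => [E|_]; last exact: Hm.
    by rewrite /nvar /nreg in Hz E *; lia.
  split=> [k' i Hk' Hi|b]; rewrite nth_set_nth /=; last by case: eqP.
  rewrite Ha //.
  have -> : (nreg + 3 * i + k' == nreg + 3 * eval s e1 + k) =
            (k' == k) && (i == eval s e1) by lia.
  by [].
- move=> e s h off q /code_cat[c1]; rewrite size_compE.
  move=> /code_cons[c2 _] o1 Hr.
  have [//|q1 [s1 r1 v1 m1]] := run_expr c1 Hr _ o1 h.
  have [Hpc Hou Hs Hm [Ha Hb]] := r1.
  exists (State (pc q1).+1 (memory q1) (rcons (out q1) (eval s e))); split.
    apply: (steps_add s1 (steps_step _)).
    by rewrite /step Hpc c2 !(onth_mem r1) // v1.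
  by split=> //=; [rewrite Hpc addn1 addnS|rewrite Hou].
- move=> c1 c2 s1 s2 s3 t1 t2 _ IH1 _ IH2 off q /code_cat[C1].
  rewrite size_compile => C2 /andP[o1 o2] Hr.
  have [q1 [S1 R1]] := IH1 _ _ C1 o1 Hr.
  have [q2 [S2 R2]] := IH2 _ _ C2 o2 R1.
  by exists q2; rewrite addnA; split=> //; apply: steps_add S1 S2.
- move=> b c1 c2 s s' t hb eb _ IH off q /code_cat[C1 /code_cat[C2 /code_cat[C3]]].
  rewrite size_compB !size_compile => C4 /and3P[o1 o2 o3] Hr.
  have [q1 [S1]] := run_cond C1 Hr o1 hb; rewrite eb => R1.
  have [q2 [S2 R2]] := IH _ _ C4 o2 R1.
  by exists q2; rewrite !addnA; split=> //; apply: steps_add S1 S2.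
- move=> b c1 c2 s s' t hb eb _ IH off q /code_cat[C1 /code_cat[C2 /code_cat[C3 C4]]].
  rewrite size_compB !size_compile in C2 C3 C4 * => /and3P[o1 o2 o3] Hr.
  have [q1 [S1]] := run_cond C1 Hr o1 hb; rewrite (negPf eb) => R1.
  have [q2 [S2 R2]] := IH _ _ C2 o3 R1.
  have [q3 [S3 R3]] := run_jump C3 R2.
  exists q3; rewrite !addnA in R3 *; split=> //.
  by apply: (steps_add (steps_add S1 S2) S3).
- move=> b c s1 s2 s3 t1 t2 hb eb _ IH1 _ IH2 off q H Ho Hr; move: (H).
  move=> /code_cat[C1 /code_cat[C2 /code_cat[C3 C4]]].
  rewrite size_compB !size_compile in C2 C3 C4 *; case/andP: (Ho) => o1 o2.
  have [q1 [S1]] := run_cond C1 Hr o1 hb; rewrite eb => R1.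
  have [q2 [S2 R2]] := IH1 _ _ C3 o2 R1.
  have [q3 [S3 R3]] := run_jump C4 R2.
  have [q4 [S4 R4]] := IH2 _ _ H Ho R3.
  exists q4; split=> //.
  exact: (steps_add (steps_add (steps_add S1 S2) S3) S4).
move=> b c s hb eb off q /code_cat[C1 /code_cat[C2 _]] /andP[o1 o2] Hr.
rewrite size_compB in C2.
have [q1 [S1]] := run_cond C1 Hr o1 hb; rewrite (negPf eb) => R1.
have [q3 [S3 R3]] := run_jump C2 R1.
exists q3; rewrite !addnA in R3 *; split=> //.
by apply: (steps_add S1 S3).
Qed.

Transparent jump.

End Machine.

(** * A Hoare logic with time bounds *)

Fixpoint wregs (c : com) : seq nat :=
  match c with
  | Set_ x _ => [:: x]
  | Seq c1 c2 | If _ c1 c2 => wregs c1 ++ wregs c2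
  | While _ c => wregs c
  | _ => [::]
  end.

Fixpoint warrs (c : com) : seq nat :=
  match c with
  | Put k _ _ => [:: k]
  | Seq c1 c2 | If _ c1 c2 => warrs c1 ++ warrs c2
  | While _ c => warrs c
  | _ => [::]
  end.

Fixpoint outputs (c : com) : bool :=
  match c with
  | Out _ => true
  | Seq c1 c2 | If _ c1 c2 => outputs c1 || outputs c2
  | While _ c => outputs c
  | _ => false
  end.

(** What a command may change is read off its syntax, so that specifications need to mention only
    what does change; [tri_frame] adds the rest. *)
Definition frame (c : com) (s s' : store) :=
  [/\ forall x, x \notin wregs c -> reg s' x = reg s x,
      forall k, k \notin warrs c -> arr s' k = arr s k
    & ~~ outputs c -> log s' = log s].

Section Rules.

Variables (disp : Order.disp_t) (D : orderType disp).
Variables (x : seq D) (key : nat -> D) (w asz : nat).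

Notation exec := (exec x key w asz).
Notation safe := (safe w asz).
Notation safeB := (safeB x w asz).
Notation evalB := (evalB key).

Lemma exec_frame c s s' t : exec c s s' t -> frame c s s'.
Proof.
elim=> {c s s' t} //=.
- by move=> y e s _; split=> //= z; rewrite inE; case: eqP.
- move=> k e1 e2 s _ _ _; split=> //= k'; rewrite inE => /negPf E.
  by rewrite E.
- move=> c1 c2 s1 s2 s3 t1 t2 _ [a1 b1 d1] _ [a2 b2 d2]; split.
  + by move=> y /=; rewrite mem_cat negb_or => /andP[h1 h2]; rewrite a2 // a1.
  + by move=> y /=; rewrite mem_cat negb_or => /andP[h1 h2]; rewrite b2 // b1.
  by rewrite negb_or => /andP[h1 h2]; rewrite d2 // d1.
- move=> b c1 c2 s s' t _ _ _ [a1 b1 d1]; split.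
  + by move=> y /=; rewrite mem_cat negb_or => /andP[h1 h2]; rewrite a1.
  + by move=> y /=; rewrite mem_cat negb_or => /andP[h1 h2]; rewrite b1.
  by rewrite negb_or => /andP[h1 h2]; rewrite d1.
- move=> b c1 c2 s s' t _ _ _ [a1 b1 d1]; split.
  + by move=> y /=; rewrite mem_cat negb_or => /andP[h1 h2]; rewrite a1.
  + by move=> y /=; rewrite mem_cat negb_or => /andP[h1 h2]; rewrite b1.
  by rewrite negb_or => /andP[h1 h2]; rewrite d1.
move=> b c s1 s2 s3 t1 t2 _ _ _ [a1 b1 d1] _ [a2 b2 d2]; split=> /=.
- by move=> y h; rewrite a2 // a1.
- by move=> y h; rewrite b2 // b1.
by move=> h; rewrite d2 // d1.
Qed.

Definition tri c s T (Q : store -> Prop) :=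
  exists s' t, [/\ exec c s s' t, t <= T & Q s'].

Lemma tri_frame c s T Q :
  tri c s T Q -> tri c s T (fun s' => frame c s s' /\ Q s').
Proof.
by case=> s' [t [E Ht HQ]]; exists s', t; split=> //; split=> //; apply: exec_frame E.
Qed.

Lemma tri_weak c s T T' (Q Q' : store -> Prop) :
  tri c s T Q -> T <= T' -> (forall s', Q s' -> Q' s') -> tri c s T' Q'.
Proof.
move=> [s' [t [E Ht HQ]]] HT HQQ; exists s', t; split=> //; last exact: HQQ.
exact: leq_trans HT.
Qed.

Lemma tri_le c s T T' Q : tri c s T Q -> T <= T' -> tri c s T' Q.
Proof. by move=> H HT; apply: (tri_weak H HT). Qed.

Lemma tri_skip s (Q : store -> Prop) : Q s -> tri Skip s 0 Q.
Proof. by move=> H; exists s, 0; split=> //; constructor. Qed.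

Lemma tri_set y e s (Q : store -> Prop) : safe s e ->
  Q (set_reg s y (eval s e)) -> tri (Set_ y e) s (esize e + 2) Q.
Proof. by move=> h H; eexists _, _; split; [constructor| |exact: H]. Qed.

Lemma tri_put k e1 e2 s (Q : store -> Prop) : safe s e1 -> safe s e2 ->
  eval s e1 < asz -> Q (set_arr s k (eval s e1) (eval s e2)) ->
  tri (Put k e1 e2) s (esize e1 + 4 + esize e2 + 1) Q.
Proof. by move=> h1 h2 h H; eexists _, _; split; [constructor| |exact: H]. Qed.

Lemma tri_out e s (Q : store -> Prop) : safe s e ->
  Q (emit s (eval s e)) -> tri (Out e) s (esize e + 1) Q.
Proof. by move=> h H; eexists _, _; split; [constructor| |exact: H]. Qed.

Lemma tri_seq c1 c2 s T1 T2 Q :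
  tri c1 s T1 (fun s' => tri c2 s' T2 Q) -> tri (Seq c1 c2) s (T1 + T2) Q.
Proof.
case=> s1 [t1 [E1 h1 [s2 [t2 [E2 h2 HQ]]]]]; exists s2, (t1 + t2); split=> //.
  by econstructor; eauto.
by lia.
Qed.

Lemma tri_if b c1 c2 s T Q : safeB s b ->
  (evalB s b -> tri c1 s T Q) -> (~~ evalB s b -> tri c2 s T Q) ->
  tri (If b c1 c2) s (bsize b + 3 + T) Q.
Proof.
move=> hb h1 h2; case: (boolP (evalB s b)) => eb.
  have [s1 [t1 [E1 H1 HQ]]] := h1 eb; exists s1, (bsize b + t1); split=> //.
    exact: EIfT.
  by lia.
have [s1 [t1 [E1 H1 HQ]]] := h2 eb; exists s1, (bsize b + t1 + 3); split=> //.
  exact: EIfF.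
by lia.
Qed.

(** The index of the invariant is an upper bound on the remaining iterations, not their exact
    number. The successor in [j.+1] pays for the final, failing test. *)
Lemma tri_while (I : nat -> store -> Prop) b c Tb :
  (forall j s, I j s -> safeB s b) ->
  (forall j s, I j s -> evalB s b -> 0 < j /\ tri c s Tb (I j.-1)) ->
  forall j s, I j s ->
  tri (While b c) s ((bsize b + 3 + Tb) * j.+1)
      (fun s' => ~~ evalB s' b /\ exists j', I j' s').
Proof.
move=> hs hI; elim=> [|j IH] s Hs; have hb := hs _ _ Hs.
  case: (boolP (evalB s b)) => eb; first by have [] := hI _ _ Hs eb.
  exists s, (bsize b + 3); split; [exact: EWhileF|lia|].
  by split=> //; exists 0.
case: (boolP (evalB s b)) => eb.
  have [_ [s1 [t1 [E1 H1 /= /IH[s2 [t2 [E2 H2 HQ]]]]]]] := hI _ _ Hs eb.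
  exists s2, (bsize b + t1 + 3 + t2); split=> //; first exact: EWhileT E2.
  by rewrite mulnS; apply: leq_add H2; lia.
exists s, (bsize b + 3); split; [exact: EWhileF| |by split=> //; exists j.+1].
by rewrite mulnS; lia.
Qed.

Lemma tri_loop (I : nat -> store -> Prop) b c Tb (Q : store -> Prop) :
  (forall j s, I j s -> safeB s b) ->
  (forall j s, I j s -> evalB s b -> 0 < j /\ tri c s Tb (I j.-1)) ->
  (forall j s, I j s -> ~~ evalB s b -> Q s) ->
  forall j s, I j s -> tri (While b c) s ((csize (While b c) + Tb) * j.+1) Q.
Proof.
move=> hs hI hQ j s hj; apply: tri_weak (tri_while hs hI hj) _ _.
  by rewrite leq_mul2r /=; lia.
by move=> s' [hb [j' hj']]; apply: hQ hj' hb.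
Qed.

Fixpoint wp (c : com) (s : store) (Q : store -> Prop) : Prop :=
  match c with
  | Skip => Q s
  | Set_ y e => safe s e /\ Q (set_reg s y (eval s e))
  | Put k e1 e2 => [/\ safe s e1, safe s e2, eval s e1 < asz
                     & Q (set_arr s k (eval s e1) (eval s e2))]
  | Out e => safe s e /\ Q (emit s (eval s e))
  | Seq c1 c2 => wp c1 s (fun s' => wp c2 s' Q)
  | If b c1 c2 => [/\ safeB s b, evalB s b -> wp c1 s Q
                    & ~~ evalB s b -> wp c2 s Q]
  | While _ _ => False
  end.

(** Code without loops executes each of its instructions at most once. The value [False] of [wp] on
    loops restricts it to such code. *)
Lemma tri_wp c s Q : wp c s Q -> tri c s (csize c) Q.
Proof.
elim: c s Q => [|y e|k e1 e2|e|c1 IH1 c2 IH2|b c1 IH1 c2 IH2|b c IH] s Q //=.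
- exact: tri_skip.
- by case; apply: tri_set.
- by case; apply: tri_put.
- by case; apply: tri_out.
- move=> h; apply: tri_seq; apply: (tri_weak (IH1 _ _ h)) => // s'; exact: IH2.
case=> hb h1 h2; apply: (@tri_le _ _ (bsize b + 3 + (csize c1 + csize c2))).
  apply: tri_if => // eb.
    by apply: (tri_le (IH1 _ _ (h1 eb))); rewrite leq_addr.
  by apply: (tri_le (IH2 _ _ (h2 eb))); rewrite leq_addl.
by lia.
Qed.

End Rules.

(** * Ranks and frequency moments *)

Section Ranks.

Variables (disp : Order.disp_t) (D : orderType disp) (kf : nat -> D).

(** The lexicographic comparison of [(kf q, q)] with [(y, b)]. The tie-break selects the cut:
    [b = p] gives the order of items, [b = 0] keeps only symbols smaller than [y], and [b = p.+1]
    with [y = kf p] includes [p] itself. *)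
Definition below (y : D) (b q : nat) : bool :=
  (kf q < y)%O || (kf q == y) && (q < b).

Definition prec (q p : nat) := below (kf p) p q.

Lemma prec_irr p : prec p p = false.
Proof. by rewrite /prec /below ltxx ltnn andbF. Qed.

Lemma prec_total p q : p != q -> prec p q || prec q p.
Proof.
rewrite /prec /below; case: (ltgtP (kf p) (kf q)) => //= _.
by case: ltngtP.
Qed.

Lemma below_prec y b q p : prec q p -> below y b p -> below y b q.
Proof.
rewrite /prec /below => /orP[h1|/andP[/eqP -> h1]] /orP[h2|/andP[/eqP <- h2]].
- by rewrite (lt_trans h1 h2).
- by rewrite h1.
- by rewrite h2.
- by rewrite eqxx (ltn_trans h1 h2) orbT.
Qed.

Lemma prec_below y b q p : ~~ below y b p -> below y b q -> prec q p.
Proof.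
rewrite /prec /below negb_or -leNgt => /andP[h1 h2].
move=> /orP[h3|/andP[/eqP E h3]]; first by rewrite (lt_le_trans h3 h1).
move: h1 h2; rewrite -E; case: (ltgtP (kf q) (kf p)) => //= _ _.
by rewrite -leqNgt; apply: leq_trans.
Qed.

(* [rank (kf p) p lo hi] is the rank of item [p]: ties are broken by the index. *)
Definition rank y b lo hi := count (below y b) (index_iota lo hi).

(** Besides order, this says that positions [lo] to [hi - 1] hold exactly the items with these
    numbers. Merging relies on it: the block that contains an item is determined by the number of
    the item. *)
Definition sorted_on (A : nat -> nat) lo hi :=
  forall p, lo <= p < hi -> A (lo + rank (kf p) p lo hi) = p.

Lemma rank_le y b lo hi : rank y b lo hi <= hi - lo.
Proof. by rewrite /rank (leq_trans (count_size _ _)) // size_iota. Qed.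

Lemma rank_cat y b lo mid hi : lo <= mid <= hi ->
  rank y b lo hi = rank y b lo mid + rank y b mid hi.
Proof.
move=> /andP[h1 h2]; rewrite /rank -count_cat /index_iota.
have -> : hi - lo = (mid - lo) + (hi - mid) by lia.
by rewrite iotaD subnKC.
Qed.

(** All items preceding [p] lie below the cut by transitivity, and so does [p], which does not
    precede itself: this is one more element. *)
Lemma rank_lt y b lo hi p : lo <= p < hi -> below y b p ->
  rank (kf p) p lo hi < rank y b lo hi.
Proof.
move=> hp hb; rewrite /rank.
have hc : count (pred1 p) (index_iota lo hi) = 1.
  by rewrite count_uniq_mem ?iota_uniq // mem_index_iota hp.
have := count_predUI (fun q => prec q p) (pred1 p) (index_iota lo hi).
have -> : count (predI (fun q => prec q p) (pred1 p)) (index_iota lo hi) = 0.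
  apply/eqP; rewrite -leqn0 leqNgt -has_count; apply/hasPn => q _ /=.
  by apply/negP => /andP[h /eqP E]; rewrite E prec_irr in h.
rewrite hc addn0 addn1 => <-.
apply: sub_count => q /= /orP[h|/eqP -> //]; exact: below_prec h hb.
Qed.

Lemma rank_inj lo hi p q : lo <= p < hi -> lo <= q < hi ->
  rank (kf p) p lo hi = rank (kf q) q lo hi -> p = q.
Proof.
move=> hp hq E; apply/eqP; apply: contraT => /prec_total /orP[] h.
  by have := rank_lt hp h; rewrite E ltnn.
by have := rank_lt hq h; rewrite E ltnn.
Qed.

(** Ranks form an injective map of a finite set to itself, hence a surjective one. *)
Lemma rank_surj lo hi i : lo <= i < hi ->
  exists2 p, lo <= p < hi & lo + rank (kf p) p lo hi = i.
Proof.
move=> hi'; set m := hi - lo.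
have hm p : p < m -> rank (kf (lo + p)) (lo + p) lo hi < m.
  move=> hp; apply: (@leq_trans (rank (kf (lo + p)) (lo + p).+1 lo hi)).
    by apply: rank_lt; [rewrite /m in hp; lia|rewrite /below eqxx ltnSn orbT].
  exact: rank_le.
pose f (u : 'I_m) := Ordinal (hm u (ltn_ord u)).
have f_inj : injective f.
  move=> u v /(congr1 val) /= /rank_inj E; apply: val_inj => /=.
  by apply: (@addnI lo); apply: E; have := ltn_ord u; have := ltn_ord v; rewrite /m; lia.
have hi2 : i - lo < m by rewrite /m; lia.
have /codomP[u /(congr1 val) /= E] := injF_onto f_inj (Ordinal hi2).
exists (lo + u); first by have := ltn_ord u; rewrite /m; lia.
by rewrite -E; lia.
Qed.

(* What binary search needs: [below y b] is monotone along [A], with cut at the rank. *)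
Lemma sorted_on_below A lo hi y b i : sorted_on A lo hi -> lo <= i < hi ->
  lo <= A i < hi /\ below y b (A i) = (i < lo + rank y b lo hi).
Proof.
move=> hA /rank_surj[p hp <-]; rewrite hA //; split=> //.
rewrite ltn_add2l; case: (boolP (below y b p)) => hb; first by rewrite rank_lt.
apply/esym/negbTE; rewrite -leqNgt; apply: sub_count => q.
exact: prec_below.
Qed.

Lemma sorted_on1 A i : A i = i -> sorted_on A i i.+1.
Proof.
move=> h p /andP[h1]; rewrite ltnS => h2.
have -> : p = i by lia.
by rewrite /rank /index_iota subSnn /= -/(prec i i) prec_irr !addn0.
Qed.

Lemma sorted_on0 A i : sorted_on A i i.
Proof. by move=> p; lia. Qed.

(* Index of the counter of the symbol [y]. *)
Definition cls K y := rank y 0 0 K.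

(** The position [cls K y] is not below the cut [(y, 0)], so its symbol is at least [y]. It is below
    the cut [(y, p.+1)], because [p] itself is, so its symbol is at most [y]. *)
Lemma cls_found A K y p : sorted_on A 0 K -> p < K -> kf p = y ->
  cls K y < K /\ kf (A (cls K y)) = y.
Proof.
move=> hA hp hy; have h0 : 0 <= p < K by [].
have hr : cls K y <= rank (kf p) p 0 K.
  apply: sub_count => q; rewrite /below ltn0 andbF orbF hy => -> //.
have hr2 : rank (kf p) p 0 K < K.
  have := rank_le (kf p) p.+1 0 K; rewrite subn0; apply: leq_trans.
  by apply: rank_lt => //; rewrite /below eqxx ltnSn orbT.
have hc : cls K y < K by apply: leq_ltn_trans hr2.
split=> //.
have [_] := @sorted_on_below A 0 K y 0 (cls K y) hA hc.
rewrite add0n ltnn /below ltn0 andbF orbF => hlt.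
have [_] := @sorted_on_below A 0 K y p.+1 (cls K y) hA hc.
rewrite add0n (leq_ltn_trans hr) /below; last first.
  by rewrite -hy; apply: rank_lt => //; rewrite /below eqxx ltnSn orbT.
by rewrite hlt /= => /andP[/eqP].
Qed.

Lemma cls_inj K p q : p < K -> q < K -> cls K (kf p) = cls K (kf q) ->
  kf p = kf q.
Proof.
move=> hp hq; case: (ltgtP (kf p) (kf q)) => // h E.
  have := @rank_lt (kf q) 0 0 K p hp; rewrite /below h => /(_ isT).
  rewrite -[X in _ < X]E ltnNge; case/negP; apply: sub_count => r.
  by rewrite /below ltn0 andbF orbF => ->.
have := @rank_lt (kf p) 0 0 K q hq; rewrite /below h => /(_ isT).
rewrite -/(cls _ _) E ltnNge; case/negP; apply: sub_count => r.
by rewrite /below ltn0 andbF orbF => ->.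
Qed.

End Ranks.

(** * Change of a moment when one symbol is added *)

Section Moments.

Variables (D : eqType) (k : nat).

(* The factor [1 - (1 - v)] makes an absent symbol contribute [0], also for
   [k = 0], where [0 ^ 0 = 1]. *)
Definition pw (v : nat) := (1 - (1 - v)) * v ^ k.

Lemma pwE v : 0 < v -> pw v = v ^ k.
Proof. by case: v => // v _; rewrite /pw mul1n. Qed.

Lemma freq_momentE (a : seq D) : freq_moment k a = \sum_(s <- undup a) pw (count_mem s a).
Proof.
apply: eq_big_seq => s; rewrite mem_undup => h.
by rewrite pwE // -has_count has_pred1.
Qed.

(** Since [pw 0 = 0], absent symbols may be summed over as well. Two windows with different supports
    can thus be compared term by term over a common range. *)
Lemma freq_moment_sub (a r : seq D) : uniq r -> {subset a <= r} ->
  freq_moment k a = \sum_(s <- r) pw (count_mem s a).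
Proof.
move=> ur hs; rewrite freq_momentE.
rewrite (bigID (fun s => s \in a)) /= [X in _ = X](bigID (fun s => s \in a)) /=.
congr (_ + _); last first.
  rewrite big1_seq; last by move=> s /andP[h]; rewrite mem_undup (negPf h).
  rewrite big1 // => s h; have -> : count_mem s a = 0; last by [].
  by apply/eqP; rewrite -leqn0 leqNgt -has_count has_pred1.
rewrite -[LHS]big_filter -[RHS]big_filter; apply: perm_big; apply: uniq_perm.
- by rewrite filter_uniq ?undup_uniq.
- by rewrite filter_uniq.
move=> s; rewrite !mem_filter mem_undup; case: (boolP (s \in a)) => //= h.
by rewrite hs.
Qed.

(** The additive form is free of truncated subtraction and serves both for an arrival and, read
    backwards, for a departure. *)
Lemma freq_moment_cons y (a : seq D) :
  freq_moment k (y :: a) + pw (count_mem y a) =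
  freq_moment k a + pw (count_mem y a).+1.
Proof.
pose r := undup (y :: a).
have ur : uniq r by rewrite undup_uniq.
have h1 : {subset y :: a <= r} by move=> s; rewrite mem_undup.
have h2 : {subset a <= r} by move=> s h; rewrite mem_undup inE h orbT.
rewrite (freq_moment_sub ur h1) (freq_moment_sub ur h2).
have yr : y \in r by rewrite mem_undup mem_head.
rewrite !(bigD1_seq y) //= eqxx add1n.
rewrite [in LHS](eq_bigr (fun s => pw (count_mem s a))); first by lia.
by move=> s hs; rewrite eq_sym (negPf hs).
Qed.

Lemma freq_moment_rcons y (a : seq D) :
  freq_moment k (rcons a y) + pw (count_mem y a) =
  freq_moment k a + pw (count_mem y a).+1.
Proof.
rewrite -freq_moment_cons; congr (_ + _).
have ur : uniq (undup (y :: a)) by rewrite undup_uniq.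
have h1 : {subset y :: a <= undup (y :: a)} by move=> s; rewrite mem_undup.
have h2 : {subset rcons a y <= undup (y :: a)}.
  by move=> s; rewrite mem_rcons mem_undup.
rewrite (freq_moment_sub ur h1) (freq_moment_sub ur h2).
by apply: eq_bigr => s _; rewrite -cats1 count_cat /= addn0 addnC.
Qed.

Lemma pw_le v m : v <= m -> pw v <= m ^ k.
Proof.
case: v => [|v] h; first by [].
by rewrite pwE //; case: (posnP k) => [->|h0]; rewrite ?expn0 ?leq_exp2r.
Qed.

Lemma freq_moment_le (a : seq D) : freq_moment k a <= size a ^ k.+1.
Proof.
rewrite freq_momentE expnS.
apply: (@leq_trans (\sum_(s <- undup a) size a ^ k)).
  by apply: leq_sum => s _; apply: pw_le; apply: count_size.
by rewrite big_const_seq count_predT iter_addn_0 mulnC leq_mul2r size_undup orbT.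
Qed.

End Moments.

(** * The algorithm *)

Declare Scope expr_scope.
Delimit Scope expr_scope with E.
Notation "a + b" := (Op Add a b) : expr_scope.
Notation "a - b" := (Op Defs.Sub a b) : expr_scope.
Notation "a * b" := (Op Mul a b) : expr_scope.
Notation "a / b" := (Op Div a b) : expr_scope.
Notation "x ::= e" := (Set_ x e%E) (at level 60).
Notation "c1 ;; c2" := (Seq c1 c2) (at level 62, right associativity).

Notation vn := 0 (only parsing).
Notation vS := 1 (only parsing).
Notation vlg := 2 (only parsing).
Notation vpow := 3 (only parsing).
Notation vell := 4 (only parsing).
Notation vN := 5 (only parsing).
Notation vt0 := 6 (only parsing).
Notation vlen := 7 (only parsing).
Notation vK := 8 (only parsing).
Notation vh := 9 (only parsing).
Notation vi := 10 (only parsing).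
Notation vlo := 11 (only parsing).
Notation vhi := 12 (only parsing).
Notation vmid := 13 (only parsing).
Notation vq := 14 (only parsing).
Notation vb := 15 (only parsing).
Notation vF := 16 (only parsing).
Notation vt := 17 (only parsing).
Notation vst := 18 (only parsing).
Notation vmd := 19 (only parsing).
Notation ven := 20 (only parsing).
Notation vr := 21 (only parsing).
Notation va := 22 (only parsing).
Notation vv := 23 (only parsing).
Notation vx := 24 (only parsing).

(* Item [p < 2 len] of the block at [t0] is the index [t0 + p] of an arriving
   symbol if [p < len], and the index [t0 + (p - len) - n] of a departing symbol
   otherwise; truncated subtraction turns the latter into some harmless valid index
   when nothing departs.  Array 0 holds the sorted items, array 1 is the merge
   buffer and array 2 holds the counters. *)
Notation item e := (V vt0 + e - (e / V vlen) * (V vlen + V vn))%E.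

(** The cut searched for is that of [below] at the symbol with index [vq] and the tie-break [vb].
    Equality of symbols is detected by two failing comparisons. *)
Definition search : com :=
  While (CLt (V vlo) (V vhi))
    (vmid ::= (V vlo + V vhi) / N 2 ;;
     va ::= Get 0 (V vmid) ;;
     vx ::= item (V va) ;;
     If (CIn (V vx) (V vq)) (vlo ::= V vmid + N 1)
       (If (CIn (V vq) (V vx)) (vhi ::= V vmid)
          (If (CLt (V va) (V vb)) (vlo ::= V vmid + N 1) (vhi ::= V vmid)))).

(** The merge runs over item numbers and not over positions: [vi] is itself an item, and its block
    of width [2 h] starts at [vst]. Ends are clipped to [vK], which need not be a multiple of
    [h]. *)
Definition merge_pre : com :=
  vst ::= (V vi / (V vh + V vh)) * (V vh + V vh) ;;
  vmd ::= V vst + V vh ;;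
  If (CLt (V vK) (V vmd)) (vmd ::= V vK) Skip ;;
  ven ::= V vst + (V vh + V vh) ;;
  If (CLt (V vK) (V ven)) (ven ::= V vK) Skip ;;
  vq ::= item (V vi) ;; vb ::= V vi ;; vlo ::= V vst ;; vhi ::= V vmd.

Definition merge_mid : com := vr ::= V vlo ;; vlo ::= V vmd ;; vhi ::= V ven.

Definition merge_post : com :=
  Put 1 (V vr + V vlo - V vmd)%E (V vi) ;; vi ::= V vi + N 1.

Definition merge_loop : com :=
  While (CLt (V vi) (V vK))
    (merge_pre ;; search ;; merge_mid ;; search ;; merge_post).

Definition copy_loop : com :=
  While (CLt (V vi) (V vK)) (Put 0 (V vi) (Get 1 (V vi)) ;; vi ::= V vi + N 1).

Definition level : com :=
  vi ::= N 0 ;; merge_loop ;; vi ::= N 0 ;; copy_loop ;; vh ::= V vh + V vh.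

Definition fill_loop : com :=
  While (CLt (V vi) (V vK))
    (Put 0 (V vi) (V vi) ;; Put 2 (V vi) (N 0) ;; vi ::= V vi + N 1).

Definition sort_items : com :=
  vi ::= N 0 ;; fill_loop ;; vh ::= N 1 ;; While (CLt (V vh) (V vK)) level.

Definition locate : com :=
  (vb ::= N 0 ;; vlo ::= N 0 ;; vhi ::= V vK) ;; search.

(** One comparison is enough: the item at the cut has a symbol that is at least the one searched
    for, so it is equal unless it is larger. *)
Definition count_post : com :=
  If (CLt (V vlo) (V vK))
    (va ::= Get 0 (V vlo) ;; vx ::= item (V va) ;;
     If (CIn (V vq) (V vx)) Skip (Put 2 (V vlo) (Get 2 (V vlo) + N 1)%E)) Skip ;;
  vt ::= V vt + N 1.

Definition count_loop : com :=
  vt ::= V vt0 - V vn ;;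
  While (CLt (V vt) (V vt0)) (vq ::= V vt ;; locate ;; count_post).

Section Program.

Variable k : nat.

Definition pwe (e : expr) : expr :=
  iter k (fun f => f * e)%E (N 1 - (N 1 - e))%E.

Definition depart : com :=
  vv ::= Get 2 (V vlo) ;; vF ::= V vF + pwe (V vv - N 1)%E - pwe (V vv) ;;
  Put 2 (V vlo) (V vv - N 1)%E.

Definition arrive : com :=
  vv ::= Get 2 (V vlo) ;; vF ::= V vF + pwe (V vv + N 1)%E - pwe (V vv) ;;
  Put 2 (V vlo) (V vv + N 1)%E.

Definition step_post : com :=
  arrive ;; vt ::= V vt + N 1 ;; If (CLt (V vt) (V vn)) Skip (Out (V vF)).

Definition step_loop : com :=
  While (CLt (V vt) (V vt0 + V vlen)%E)
    (If (CLt (V vt) (V vn)) Skip ((vq ::= V vt - V vn) ;; locate ;; depart) ;;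
     vq ::= V vt ;; locate ;; step_post).

Definition block_pre : com :=
  vlen ::= V vN - V vt0 ;;
  If (CLt (V vell) (V vlen)) (vlen ::= V vell) Skip ;;
  vK ::= V vlen + V vlen.

Definition block : com :=
  block_pre ;; sort_items ;; count_loop ;; step_loop ;; vt0 ::= V vt0 + V vlen.

Definition lg_loop : com :=
  While (CLt (V vpow) (V vn)) (vpow ::= V vpow + V vpow ;; vlg ::= V vlg + N 1).

Definition setup_post : com :=
  vell ::= V vS / V vlg + N 1 ;; vN ::= V vn + V vn - N 1.

Definition prog : com :=
  vpow ::= N 1 ;; lg_loop ;; setup_post ;; While (CLt (V vt0) (V vN)) block.

End Program.

Lemma wfE_pwe k e : wfE (pwe k e) = wfE e.
Proof. by rewrite /pwe; elim: k => /= [|k ->] //; rewrite andbb. Qed.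

(** Factors are multiplied on the right, so the partial product stays in one word whatever [k] is.
    The two further temporaries come from the nested subtractions. Hence a fixed number of registers
    serves all [k]. *)
Lemma temps_pwe k e : temps (pwe k e) <= (temps e).+2.
Proof. by rewrite /pwe; elim: k => /= [|k IH]; lia. Qed.

Lemma ok_prog k : ok (prog k).
Proof.
rewrite /prog /= /okE /= !wfE_pwe /=.
have /= h1 := temps_pwe k (V vv); have /= h2 := temps_pwe k (V vv - N 1)%E.
have /= h3 := temps_pwe k (V vv + N 1)%E.
by rewrite /nvar /nreg !andbT /=; lia.
Qed.

Ltac bounds := do ?split=> //; lia.

Lemma eval_pwe k s e : eval s (pwe k e) = pw k (eval s e).
Proof.
rewrite /pwe /pw; elim: k => [|k IH] /=; first by rewrite muln1.
by rewrite IH expnSr mulnA.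
Qed.

(** The partial products are the values [pw j] with [j <= k], bounded by [b ^ j <= b ^ k]. *)
Lemma safe_pwe w asz k s e b : safe w asz s e -> eval s e <= b -> 0 < b ->
  1 < 2 ^ w -> b ^ k < 2 ^ w -> safe w asz s (pwe k e).
Proof.
move=> he hb b0 h1; rewrite /pwe; elim: k => [|k IH] hk /=; first by bounds.
have hk' : b ^ k < 2 ^ w.
  by apply: leq_ltn_trans hk; rewrite expnS leq_pmull.
split=> //; first exact: IH.
have -> : eval s (iter k (fun f => (f * e)%E) (N 1 - (N 1 - e))%E) = pw k (eval s e).
  exact: eval_pwe.
apply: leq_ltn_trans hk; rewrite expnSr; apply: leq_mul => //.
exact: pw_le.
Qed.

(** * Correctness of one block *)

Section Block.

Variables (disp : Order.disp_t) (D : orderType disp).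
Variables (x : seq D) (key : nat -> D) (w n ell k : nat).

Notation asz := (ell + ell).
Notation tri := (tri x key w asz).

Hypothesis n_gt0 : 0 < n.
Hypothesis size_x : size x = n.*2.-1.
Hypothesis word : 100 + 16 * (n + ell) < 2 ^ w.

Variables (t0 len : nat).
Hypothesis len_gt0 : 0 < len.
Hypothesis len_le : len <= ell.
Hypothesis end_le : t0 + len <= n.*2.-1.

Notation K := (len + len).
Notation ix p := (t0 + p - p %/ len * (len + n)).
Definition kf p := key (ix p).

Definition env s :=
  [/\ reg s vn = n, reg s vt0 = t0, reg s vlen = len & reg s vK = K].

Lemma div_len p : p < K -> p %/ len <= 1.
Proof. by move=> h; rewrite -ltnS ltn_divLR // mulSn mul1n. Qed.

Lemma div_mul_len p : p < K -> p %/ len * (len + n) <= len + n.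
Proof. by move=> /div_len; case: (p %/ len) => [|[|m]] //; rewrite ?mul1n. Qed.

Lemma ix_lt p : p < K -> ix p < n.*2.-1.
Proof.
move=> h; case: (ltnP p len) => h2; first by rewrite divn_small //; lia.
have -> : p %/ len = 1.
  by apply/eqP; rewrite eqn_leq div_len // divn_gt0.
by lia.
Qed.

(** Along the array [below] is a threshold at [c], so the interval always brackets [c], and its
    length bound [2 ^ j] halves in every iteration. *)
Lemma search_spec j c s : env s -> reg s vhi <= K -> reg s vq < n.*2.-1 ->
  reg s vlo <= c <= reg s vhi -> reg s vhi - reg s vlo < 2 ^ j ->
  (forall i, reg s vlo <= i < reg s vhi -> arr s 0 i < K /\
     below kf (key (reg s vq)) (reg s vb) (arr s 0 i) = (i < c)) ->
  tri search s (csize search * j.+1) (fun s' => reg s' vlo = c).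
Proof.
move=> Es hK hq hc hj hA.
pose I j (s' : store) := [/\ env s', reg s' vq = reg s vq, reg s' vb = reg s vb,
  arr s' 0 = arr s 0 & [/\ reg s vlo <= reg s' vlo, reg s' vhi <= reg s vhi,
  reg s' vlo <= c <= reg s' vhi & reg s' vhi - reg s' vlo < 2 ^ j]].
have I0 : I j s by split.
rewrite /search; set b := CLt _ _; set body := (X in While b X).
apply: (@tri_weak _ _ _ _ _ _ _ _ ((bsize b + 3 + csize body) * j.+1)).
- apply: (@tri_while _ _ _ _ _ _ I) I0; first by [].
  move=> {hj} {}j s' [[e1 e2 e3 e4] eq eb eA [h1 h2 h3 h4]] /= hlt.
  case: j h4 => [|j] h4; first by rewrite expn0 in h4; lia.
  split=> //=; apply: tri_wp => /=.
  have hm1 : reg s' vlo <= (reg s' vlo + reg s' vhi) %/ 2 by lia.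
  have hm2 : (reg s' vlo + reg s' vhi) %/ 2 < reg s' vhi by lia.
  have hm3 : (reg s' vlo + reg s' vhi) %/ 2 - reg s' vlo < 2 ^ j by rewrite expnS in h4; lia.
  have hm4 : reg s' vhi - ((reg s' vlo + reg s' vhi) %/ 2).+1 < 2 ^ j.
    by rewrite expnS in h4; lia.
  set m := _ %/ 2 in hm1 hm2 hm3 hm4 *.
  have [hA1 hA2] : arr s 0 m < K /\
     below kf (key (reg s vq)) (reg s vb) (arr s 0 m) = (m < c) by apply: hA; lia.
  rewrite /= e1 e2 e3 eq eb eA.
  have hx := ix_lt hA1; have hd := div_mul_len hA1; have hd1 := div_len hA1.
  rewrite /below /kf in hA2.
  split; first by bounds.
  split; first by bounds.
  split; first by bounds.
  rewrite size_x; split; [by []| |].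
    move=> hlt1; split; first by bounds.
    rewrite hlt1 /= in hA2; split=> //=; split=> //=; lia.
  move=> hlt1; rewrite (negPf hlt1) /= in hA2; split; [by []| |].
    move=> hlt2; split=> //; rewrite gt_eqF //= in hA2; split=> //=; split=> //=; lia.
  move=> hlt2; have E : key (ix (arr s 0 m)) = key (reg s vq).
    by case: ltgtP hlt1 hlt2.
  rewrite E eqxx /= in hA2; split; [by []| |] => hlt3; split; try by bounds.
    by split=> //=; split=> //=; lia.
  by split=> //=; split=> //=; lia.
- by rewrite leq_mul2r /= leq_addr.
move=> s' [/= hnlt [j' [_ _ _ _ [h1 h2 h3 h4]]]]; lia.
Qed.

Lemma env_frame c s s' : frame c s s' ->
  all (fun v => v \notin wregs c) [:: vn; vt0; vlen; vK] -> env s -> env s'.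
Proof.
move=> [F _ _] /= /and5P[h1 h2 h3 h4 _] [e1 e2 e3 e4].
by split; rewrite F.
Qed.

Variable lam : nat.
Hypothesis K_lt : K < 2 ^ lam.

Notation tsearch := (csize search * lam.+1).

Lemma search_sorted c s A lo hi : env s -> arr s 0 = A -> sorted_on kf A lo hi ->
  reg s vlo = lo -> reg s vhi = hi -> lo <= hi <= K -> reg s vq < n.*2.-1 ->
  c = lo + rank kf (key (reg s vq)) (reg s vb) lo hi ->
  tri search s tsearch (fun s' => reg s' vlo = c).
Proof.
move=> Es eA hA elo ehi hlo hq ->; apply: search_spec => //; rewrite ?elo ?ehi.
- by lia.
- by have := rank_le kf (key (reg s vq)) (reg s vb) lo hi; lia.
- by lia.
move=> i hi'; rewrite eA; have [h1 h2] := sorted_on_below (key (reg s vq)) (reg s vb) hA hi'.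
by split=> //; lia.
Qed.

(** * Merging by ranks *)

Section Merge.

Variables (h : nat) (A : nat -> nat).
Hypothesis h_gt0 : 0 < h.
Hypothesis h_lt : h < K.

Definition level_sorted (B : nat -> nat) g :=
  forall b, sorted_on kf B (minn (b * g) K) (minn (b.+1 * g) K).

Hypothesis A_sorted : level_sorted A h.

Notation st i := (i %/ (h + h) * (h + h)).
Notation md i := (minn (st i + h) K).
Notation en i := (minn (st i + (h + h)) K).

(** The final place of item [i] in its merged block. The code obtains this rank by [rank_cat] as the
    sum of the ranks in the two halves. *)
Definition slot i := st i + rank kf (kf i) i (st i) (en i).

Lemma slot_block i : i < K -> st i <= slot i < en i.
Proof.
move=> hi; have h1 : st i <= i by apply: leq_divM.
have h2 : i < st i + (h + h) by rewrite addnC -mulSn ltn_ceil //; lia.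
rewrite leq_addr /= /slot.
have := rank_le kf (kf i) i.+1 (st i) (en i).
have : rank kf (kf i) i (st i) (en i) < rank kf (kf i) i.+1 (st i) (en i).
  by apply: rank_lt; [lia|rewrite /below eqxx ltnSn orbT].
by lia.
Qed.

Lemma slot_div i : i < K -> slot i %/ (h + h) = i %/ (h + h).
Proof.
move=> hi; have /andP[h1 h2] := slot_block hi.
have -> : slot i = st i + (slot i - st i) by lia.
rewrite divnMDl; last by lia.
by rewrite [X in _ + X]divn_small ?addn0; lia.
Qed.

Lemma slot_inj p q : p < K -> q < K -> slot p = slot q -> p = q.
Proof.
move=> hp hq E; have Ed := slot_div hp; rewrite E slot_div // in Ed.
have b i : i < K -> st i <= i < en i.
  move=> hi; have h1 : st i <= i by apply: leq_divM.
  have h2 : i < st i + (h + h) by rewrite addnC -mulSn ltn_ceil //; lia.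
  by lia.
move: E (b _ hp) (b _ hq); rewrite /slot Ed => /addnI E hp' hq'.
exact: rank_inj hp' hq' E.
Qed.

Lemma slots_sorted B : (forall p, p < K -> B (slot p) = p) ->
  level_sorted B (h + h).
Proof.
move=> hB b p /andP[h1 h2].
have hp : p < K by lia.
have E : p %/ (h + h) = b.
  have -> : p = b * (h + h) + (p - b * (h + h)) by lia.
  rewrite divnMDl; last by lia.
  by rewrite [X in _ + X]divn_small ?addn0; lia.
have := hB p hp; rewrite /slot E.
have -> : minn (b * (h + h)) K = b * (h + h) by lia.
by have -> : b * (h + h) + (h + h) = b.+1 * (h + h) by rewrite mulSn addnC.
Qed.

Lemma merge_pre_spec s : env s -> reg s vh = h -> reg s vi < K ->
  tri merge_pre s (csize merge_pre) (fun s' =>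
    [/\ [/\ reg s' vst = st (reg s vi), reg s' vmd = md (reg s vi)
          & reg s' ven = en (reg s vi)],
        reg s' vq = ix (reg s vi), reg s' vb = reg s vi, reg s' vlo = st (reg s vi)
      & reg s' vhi = md (reg s vi)]).
Proof.
move=> [e1 e2 e3 e4] eh hi; apply: tri_wp => /=; rewrite e1 e2 e3 e4 eh.
have h1 : st (reg s vi) <= reg s vi by apply: leq_divM.
have h2 : reg s vi %/ (h + h) <= reg s vi by apply: leq_div.
have hx := ix_lt hi; have hd := div_mul_len hi; have hd1 := div_len hi.
set d := _ %/ (h + h) in h1 h2 *; set i := reg s vi in h1 h2 hi hx hd hd1 *.
split; first by bounds.
split; first by bounds.
split; first by bounds.
  move=> H1; split=> //; split; first by bounds.
  split; first by bounds.
    move=> H2; split=> //; split; first by bounds.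
    split=> //; split=> //; split=> //; split; [split|..]; lia.
  move=> H2; split; first by bounds.
  split=> //; split=> //; split=> //; split; [split|..]; lia.
move=> H1; split; first by bounds.
split; first by bounds.
  move=> H2; split=> //; split; first by bounds.
  split=> //; split=> //; split=> //; split; [split|..]; lia.
move=> H2; split; first by bounds.
split=> //; split=> //; split=> //; split; [split|..]; lia.
Qed.

Lemma merge_body_spec s : env s -> reg s vh = h -> reg s vi < K ->
  arr s 0 = A ->
  tri (merge_pre ;; search ;; merge_mid ;; search ;; merge_post) s
    (csize merge_pre + (tsearch + (csize merge_mid + (tsearch + csize merge_post))))
    (fun s' => [/\ reg s' vi = (reg s vi).+1, arr s' 0 = A &
      forall p, arr s' 1 p = if p == slot (reg s vi) then reg s vi else arr s 1 p]).
Proof.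
move=> Es eh hi eA; set i := reg s vi in hi *.
have h1 : st i <= i by apply: leq_divM.
have h2 : i < st i + (h + h) by rewrite addnC -mulSn ltn_ceil //; lia.
have sb := slot_block hi.
(* In blocks of width [h], the two halves have numbers [2 b] and [2 b + 1] for [b = i %/ (h + h)]. A
   right half that would start beyond [K] is clipped to an empty one. *)
have A1 : sorted_on kf A (st i) (md i).
  have := @A_sorted (i %/ (h + h)).*2.
  have -> : (i %/ (h + h)).*2 * h = st i by rewrite -muln2 -mulnA mul2n addnn.
  rewrite mulSn; have -> : (i %/ (h + h)).*2 * h = st i.
    by rewrite -muln2 -mulnA mul2n addnn.
  have -> : minn (st i) K = st i by lia.
  by rewrite addnC.
have A2 : sorted_on kf A (md i) (en i).
  have := @A_sorted (i %/ (h + h)).*2.+1; rewrite !mulSn.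
  have -> : (i %/ (h + h)).*2 * h = st i by rewrite -muln2 -mulnA mul2n addnn.
  have -> : h + (h + st i) = st i + (h + h) by lia.
  by rewrite (addnC h (st i)).
have rc : rank kf (kf i) i (st i) (en i) =
          rank kf (kf i) i (st i) (md i) + rank kf (kf i) i (md i) (en i).
  by apply: rank_cat; lia.
apply: tri_seq.
apply: tri_weak (tri_frame (merge_pre_spec Es eh hi)) (leqnn _) _ => s1.
rewrite -/i => -[F1 [[g1 g2 g3] g4 g5 g6 g7]].
have Es1 := env_frame F1 isT Es; have [r1 a1 _] := F1.
apply: tri_seq.
apply: tri_weak (tri_frame (@search_sorted
  (st i + rank kf (kf i) i (st i) (md i)) s1 A (st i) (md i) Es1 _ A1 g6 g7 _ _ _))
  (leqnn _) _.
- by rewrite a1.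
- by lia.
- by rewrite g4 ix_lt.
- by rewrite g4 g5.
move=> s2 [F2 e2]; have Es2 := env_frame F2 isT Es1; have [r2 a2 _] := F2.
apply: tri_seq; apply: tri_weak (tri_frame (@tri_wp _ _ _ _ _ _ merge_mid s2
  (fun s' => [/\ reg s' vr = reg s2 vlo, reg s' vlo = md i & reg s' vhi = en i]) _))
  (leqnn _) _.
  by rewrite /= (r2 vmd) // (r2 ven) // g2 g3.
move=> s3 [F3 [f1 f2 f3]]; have Es3 := env_frame F3 isT Es2; have [r3 a3 _] := F3.
have eq3 : reg s3 vq = ix i by rewrite r3 // r2.
have eb3 : reg s3 vb = i by rewrite r3 // r2.
apply: tri_seq; apply: tri_weak (tri_frame (@search_sorted
  (md i + rank kf (kf i) i (md i) (en i)) s3 A (md i) (en i) Es3 _ A2 f2 f3 _ _ _))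
  (leqnn _) _.
- by rewrite a3 // a2 // a1.
- by lia.
- by rewrite eq3 ix_lt.
- by rewrite eq3 eb3.
move=> s4 [F4 e4]; have [r4 a4 _] := F4.
have er : reg s4 vr = st i + rank kf (kf i) i (st i) (md i) by rewrite r4 // f1.
have em : reg s4 vmd = md i by rewrite r4 // r3 // r2.
have ei : reg s4 vi = i by rewrite r4 // r3 // r2 // r1.
apply: tri_wp => /=; rewrite er em ei e4.
have -> : st i + rank kf (kf i) i (st i) (md i) +
  (md i + rank kf (kf i) i (md i) (en i)) - md i = slot i.
  by rewrite /slot rc; lia.
have k1 := rank_le kf (kf i) i (st i) (md i).
have k2 := rank_le kf (kf i) i (md i) (en i).
split=> //; [by bounds|by lia|].
split; first by bounds.
split; [by rewrite addn1|by rewrite a4 // a3 // a2 // a1|].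
by move=> p; rewrite a4 // a3 // a2 // a1.
Qed.

Notation tmerge :=
  (csize merge_pre + (tsearch + (csize merge_mid + (tsearch + csize merge_post)))).

Lemma merge_loop_spec s : env s -> reg s vh = h -> reg s vi = 0 ->
  arr s 0 = A ->
  tri merge_loop s ((csize merge_loop + tmerge) * K.+1)
    (fun s' => forall p, p < K -> arr s' 1 (slot p) = p).
Proof.
move=> Es eh ei eA.
pose I j (s' : store) := [/\ env s', reg s' vh = h, arr s' 0 = A, K = reg s' vi + j
  & forall p, p < reg s' vi -> arr s' 1 (slot p) = p].
apply: (@tri_loop _ _ _ _ _ _ I); first by [].
- move=> j s' [Es' eh' eA' eK hp]; have [_ _ _ e4] := Es'; rewrite /= e4 => hi.
  split; first by lia.
  apply: tri_weak (tri_frame (merge_body_spec Es' eh' hi eA')) (leqnn _) _.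
  move=> s1 [F [g1 g2 g3]]; have [r1 _ _] := F.
  split=> //; [exact: env_frame F isT Es'|by rewrite r1|by lia|].
  move=> p; rewrite g1 ltnS leq_eqVlt g3 => /orP[/eqP -> |hlt]; first by rewrite eqxx.
  (* No earlier entry is overwritten, since equal slots would mean equal items. *)
  case: eqP => [E|_]; last exact: hp.
  by apply/esym; apply: slot_inj E; lia.
- move=> j s' [[_ _ _ e4] _ _ _ hp] /= hn p hpK; apply: hp.
  by move: hn; rewrite e4; lia.
by split; rewrite ?ei.
Qed.

End Merge.

Notation tmerge :=
  (csize merge_pre + (tsearch + (csize merge_mid + (tsearch + csize merge_post)))).

Lemma copy_loop_spec s : env s -> reg s vi = 0 ->
  (forall p, p < K -> arr s 1 p < 2 ^ w) ->
  tri copy_loop s ((csize copy_loop + csize copy_loop) * K.+1)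
    (fun s' => forall p, p < K -> arr s' 0 p = arr s 1 p).
Proof.
move=> Es ei hB.
pose I j (s' : store) := [/\ env s', arr s' 1 = arr s 1, K = reg s' vi + j
  & forall p, p < reg s' vi -> arr s' 0 p = arr s 1 p].
apply: tri_le (@tri_loop _ _ _ _ _ _ I _ _ (csize copy_loop) _ _ _ _ K s _) (leqnn _).
- by [].
- move=> j s' [Es' eB eK hp]; have [_ _ _ e4] := Es'; rewrite /= e4 => hi.
  split; first by lia.
  apply: tri_le; [apply: tri_wp => /=|by []].
  split; [by []|by bounds|by bounds|split; first by bounds].
  split=> //=; first by lia.
  move=> p hp'; case: eqP => [->|ne] /=; first by rewrite eB.
  by apply: hp; lia.
- move=> j s' [[_ _ _ e4] _ _ hp] /= hn p hpK; apply: hp.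
  by move: hn; rewrite e4; lia.
by split; rewrite ?ei.
Qed.

Notation tlevel := (csize level + ((csize merge_loop + tmerge) * K.+1 +
  (csize copy_loop + csize copy_loop) * K.+1)).

Lemma level_sorted_eq A B g : (forall p, p < K -> A p = B p) ->
  level_sorted A g -> level_sorted B g.
Proof.
move=> hAB hA b p hp; rewrite -hAB; first exact: hA.
have h0 : minn (b * g) K <= p < minn (b.+1 * g) K by [].
have := rank_le kf (kf p) p.+1 (minn (b * g) K) (minn (b.+1 * g) K).
have := @rank_lt _ _ kf (kf p) p.+1 _ _ p h0.
by rewrite /below eqxx ltnSn orbT => /(_ isT); lia.
Qed.

Lemma level_sorted_lt A g p : level_sorted A g -> 0 < g -> p < K -> A p < K.
Proof.
move=> hA hg hp; have h1 : p %/ g * g <= p by apply: leq_divM.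
have h2 : p < (p %/ g).+1 * g by apply: ltn_ceil.
have hp' : minn (p %/ g * g) K <= p < minn ((p %/ g).+1 * g) K by lia.
by have [/andP[_ h3] _] := sorted_on_below (kf p) p (@hA (p %/ g)) hp'; lia.
Qed.

Lemma level_spec s : env s -> 0 < reg s vh < K -> level_sorted (arr s 0) (reg s vh) ->
  tri level s tlevel (fun s' =>
    reg s' vh = reg s vh + reg s vh /\ level_sorted (arr s' 0) (reg s' vh)).
Proof.
move=> Es /andP[h0 hK] hA; set g := reg s vh in h0 hK hA *.
apply: tri_le.
  apply: tri_seq; apply: tri_weak (tri_frame (@tri_wp _ _ _ _ _ _ _ s
    (fun s' => reg s' vi = 0) _)) (leqnn _) _ => /=; first by bounds.
  move=> s1 [F1 e1]; have Es1 := env_frame F1 isT Es; have [r1 a1 _] := F1.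
  have eh1 : reg s1 vh = g by rewrite r1.
  have ea1 : arr s1 0 = arr s 0 by rewrite a1.
  apply: tri_seq.
  apply: tri_weak (tri_frame (merge_loop_spec h0 hK hA Es1 eh1 e1 ea1)) (leqnn _) _.
  move=> s2 [F2 e2]; have Es2 := env_frame F2 isT Es1; have [r2 a2 _] := F2.
  have hB := slots_sorted h0 hK e2.
  have hgg : 0 < g + g by lia.
  have eh2 : reg s2 vh = g by rewrite r2.
  apply: tri_seq; apply: tri_weak (tri_frame (@tri_wp _ _ _ _ _ _ _ s2
    (fun s' => reg s' vi = 0) _)) (leqnn _) _ => /=; first by bounds.
  move=> s3 [F3 e3]; have Es3 := env_frame F3 isT Es2; have [r3 a3 _] := F3.
  have ea3 : arr s3 1 = arr s2 1 by rewrite a3.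
  apply: tri_seq; apply: tri_weak (tri_frame (copy_loop_spec Es3 e3 _)) (leqnn _) _.
    by move=> p hp; rewrite ea3; have := level_sorted_lt hB hgg hp; lia.
  move=> s4 [F4 e4]; have [r4 a4 _] := F4.
  have eh4 : reg s4 vh = g by rewrite r4 // r3.
  apply: tri_wp => /=; rewrite eh4; split; first by bounds.
  split=> //=; apply: level_sorted_eq hB => p hp.
  by rewrite e4 // ea3.
by rewrite /level /=; lia.
Qed.

Lemma fill_loop_spec s : env s -> reg s vi = 0 ->
  tri fill_loop s ((csize fill_loop + csize fill_loop) * K.+1)
    (fun s' => forall p, p < K -> arr s' 0 p = p /\ arr s' 2 p = 0).
Proof.
move=> Es ei.
pose I j (s' : store) := [/\ env s', K = reg s' vi + j
  & forall p, p < reg s' vi -> arr s' 0 p = p /\ arr s' 2 p = 0].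
apply: tri_le (@tri_loop _ _ _ _ _ _ I _ _ (csize fill_loop) _ _ _ _ K s _) (leqnn _).
- by [].
- move=> j s' [Es' eK hp]; have [_ _ _ e4] := Es'; rewrite /= e4 => hi.
  split; first by lia.
  apply: tri_le; [apply: tri_wp => /=|by []].
  split; [by []|by bounds|by bounds|split; [by []|by bounds|by bounds|]].
  split; first by bounds.
  split=> //=; first by lia.
  move=> p hp'; case: eqP => [->|ne] //=.
  by apply: hp; lia.
- move=> j s' [[_ _ _ e4] _ hp] /= hn p hpK; apply: hp.
  by move: hn; rewrite e4; lia.
by split; rewrite ?ei.
Qed.

Lemma identity_sorted A : (forall p, p < K -> A p = p) -> level_sorted A 1.
Proof.
move=> hA b; rewrite !muln1; case: (ltnP b K) => hb.
  have -> : minn b.+1 K = b.+1 by lia.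
  by apply: sorted_on1; apply: hA.
have -> : minn b.+1 K = K by lia.
exact: sorted_on0.
Qed.

Notation tsort := (csize sort_items + ((csize fill_loop + csize fill_loop) * K.+1 +
  (csize sort_items + tlevel) * lam.+1)).

Lemma sort_spec s : env s ->
  tri sort_items s tsort (fun s' => sorted_on kf (arr s' 0) 0 K /\
    forall p, p < K -> arr s' 2 p = 0).
Proof.
move=> Es; apply: tri_le.
  apply: tri_seq; apply: tri_weak (tri_frame (@tri_wp _ _ _ _ _ _ _ s
    (fun s' => reg s' vi = 0) _)) (leqnn _) _ => /=; first by bounds.
  move=> s1 [F1 e1]; have Es1 := env_frame F1 isT Es.
  apply: tri_seq; apply: tri_weak (tri_frame (fill_loop_spec Es1 e1)) (leqnn _) _.
  move=> s2 [F2 e2]; have Es2 := env_frame F2 isT Es1.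
  apply: tri_seq; apply: tri_weak (tri_frame (@tri_wp _ _ _ _ _ _ _ s2
    (fun s' => reg s' vh = 1) _)) (leqnn _) _ => /=; first by bounds.
  move=> s3 [F3 e3]; have Es3 := env_frame F3 isT Es2; have [_ a3 _] := F3.
  (* [j] bounds the number of doublings left before a single block covers all items. *)
  pose I j (s' : store) := [/\ env s', 0 < reg s' vh, K <= reg s' vh * 2 ^ j,
    level_sorted (arr s' 0) (reg s' vh) & arr s' 2 = arr s2 2].
  apply: (@tri_loop _ _ _ _ _ _ I _ _ tlevel _ _ _ _ lam); first by [].
  - move=> j s' [Es' h0 hj hl e2']; have [_ _ _ e4] := Es'; rewrite /= e4 => hlt.
    split; first by case: j hj => //; rewrite expn0; lia.
    have hb : 0 < reg s' vh < K by rewrite h0.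
    apply: tri_weak (tri_frame (level_spec Es' hb hl)) (leqnn _) _.
    move=> s4 [F [g1 g2]]; have [_ a4 _] := F.
    split=> //; [exact: env_frame F isT Es'|by lia| |by rewrite a4].
    case: j hj => [|j]; first by rewrite expn0; lia.
    by rewrite expnS g1 /=; move: (2 ^ j) => z; lia.
  - move=> j s' [[_ _ _ e4] h0 hj hl e2'] /=; rewrite e4 => hn.
    split; last by move=> p hp; rewrite e2'; case: (e2 p hp).
    have := hl 0; rewrite mul0n mul1n min0n.
    by have -> : minn (reg s' vh) K = K by lia.
  split=> //; rewrite ?e3 ?a3 //; first by lia.
  by apply: identity_sorted => p /e2[].
by rewrite /sort_items /=; lia.
Qed.

Notation tlocate := (csize locate + tsearch).

Lemma locate_spec s : env s -> sorted_on kf (arr s 0) 0 K ->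
  reg s vq < n.*2.-1 ->
  tri locate s tlocate (fun s' => reg s' vlo = cls kf K (key (reg s vq))).
Proof.
move=> Es hA hq; apply: tri_le.
  apply: tri_seq; apply: tri_weak (tri_frame (@tri_wp _ _ _ _ _ _ _ s
    (fun s' => [/\ reg s' vb = 0, reg s' vlo = 0 & reg s' vhi = K]) _)) (leqnn _) _.
    by have [_ _ _ e4] := Es; rewrite /= e4; bounds.
  move=> s1 [F1 [e1 e2 e3]]; have Es1 := env_frame F1 isT Es; have [r1 a1 _] := F1.
  apply: (@search_sorted _ s1 (arr s1 0) 0 K) => //.
  - by rewrite a1.
  - by lia.
  - by rewrite r1.
  by rewrite e1 r1.
by rewrite /locate /=; lia.
Qed.

(** * Multiplicities and the sliding window *)

Definition keys lo hi := [seq key j | j <- index_iota lo hi].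

Lemma keys_cons lo hi : lo < hi -> keys lo hi = key lo :: keys lo.+1 hi.
Proof. by move=> h; rewrite /keys /index_iota -[in LHS](subnSK h). Qed.

Lemma keys_rcons lo hi : lo <= hi -> keys lo hi.+1 = rcons (keys lo hi) (key hi).
Proof.
by move=> h; rewrite /keys /index_iota subSn // -addn1 iotaD map_cat subnKC //= cats1.
Qed.

Lemma size_keys lo hi : size (keys lo hi) = hi - lo.
Proof. by rewrite size_map size_iota. Qed.

(** Only symbols of items have counters; any other symbol of the window neither enters nor leaves it
    during the block. *)
Definition tally (C : nat -> nat) (a : seq D) :=
  forall p, p < K -> C (cls kf K (kf p)) = count_mem (kf p) a.

(** Different symbols have different counters by [cls_inj], so one write affects one symbol. *)
Lemma tally_update C a b y p v : tally C a -> p < K -> kf p = y ->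
  count_mem y b = v ->
  (forall z, z != y -> count_mem z b = count_mem z a) ->
  tally (fun i => if i == cls kf K y then v else C i) b.
Proof.
move=> hC hp hy hv hz q hq; case: eqVneq => [|ne].
  by rewrite -hy => /(cls_inj hq hp) ->; rewrite hy.
by rewrite hC // hz //; apply: contraNneq ne => ->.
Qed.

Lemma tally_eq C a b : tally C a ->
  (forall p, p < K -> count_mem (kf p) b = count_mem (kf p) a) -> tally C b.
Proof. by move=> hC hab p hp; rewrite hC // hab. Qed.

Lemma count_mem_rcons (z y : D) a :
  count_mem z (rcons a y) = count_mem z a + (y == z).
Proof. by rewrite -cats1 count_cat /= addn0. Qed.

Lemma count_post_spec s a y : env s -> sorted_on kf (arr s 0) 0 K ->
  reg s vq < n.*2.-1 -> y = key (reg s vq) -> reg s vlo = cls kf K y ->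
  tally (arr s 2) a -> size a < n -> reg s vt < t0 ->
  tri count_post s (csize count_post) (fun s' =>
    [/\ tally (arr s' 2) (rcons a y), reg s' vt = (reg s vt).+1 & arr s' 0 = arr s 0]).
Proof.
move=> Es hA hq ey elo hC ha ht; have [e1 e2 e3 e4] := Es.
have hta : (forall p, p < K -> kf p != y) -> tally (arr s 2) (rcons a y).
  move=> hp; apply: tally_eq hC _ => p /hp ne.
  by rewrite count_mem_rcons eq_sym (negPf ne) addn0.
apply: tri_wp => /=; rewrite elo e1 e2 e3 e4; split; first by [].
  move=> hc; have hcK : 0 <= cls kf K y < K by [].
  have [/andP[_ hl] hb] := sorted_on_below y 0 hA hcK.
  rewrite add0n ltnn /below ltn0 andbF orbF in hb.
  have hx := ix_lt hl; have hd := div_mul_len hl; have hd1 := div_len hl.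
  split; first by bounds.
  split; first by bounds.
  rewrite size_x; split; [by bounds| |].
    move=> hlt; split; first by bounds.
    split; [|by rewrite addn1|by []]; apply: hta => p hp; apply/eqP => hy.
    have [_ E] := cls_found hA hp hy.
    by move: hlt; rewrite -ey -/(kf _) E ltxx.
  rewrite -leNgt => hle.
  have E : kf (arr s 0 (cls kf K y)) = y.
    have hle' : (kf (arr s 0 (cls kf K y)) <= y)%O by rewrite [X in (_ <= X)%O]ey.
    by apply/eqP; rewrite eq_le hle' leNgt hb.
  have hv : arr s 2 (cls kf K y) = count_mem y a by rewrite -{1}E hC // E.
  have hv2 : count_mem y a <= size a := count_size _ _.
  rewrite hv; split; [by bounds|by bounds|by lia|split; first by bounds].
  split; [|by rewrite addn1|by []].
  apply: (tally_update hC hl E); first by rewrite count_mem_rcons eqxx.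
  by move=> z ne; rewrite count_mem_rcons eq_sym (negPf ne) addn0.
move=> hc; split; first by bounds.
split; [|by rewrite addn1|by []]; apply: hta => p hp; apply/eqP => hy.
by have [h _] := cls_found hA hp hy; rewrite h in hc.
Qed.

Notation tcount := (csize count_loop + (csize count_loop +
  (csize count_loop + tlocate)) * n.+1).

Lemma count_loop_spec s : env s -> sorted_on kf (arr s 0) 0 K ->
  (forall p, p < K -> arr s 2 p = 0) ->
  tri count_loop s tcount (fun s' =>
    [/\ tally (arr s' 2) (keys (t0 - n) t0), arr s' 0 = arr s 0
      & reg s' vt = t0]).
Proof.
move=> Es hA h0.
apply: tri_le.
  apply: tri_seq; apply: tri_weak (tri_frame (@tri_wp _ _ _ _ _ _ _ s
    (fun s' => reg s' vt = t0 - n) _)) (leqnn _) _.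
    by have [e1 e2 _ _] := Es; rewrite /= e1 e2; bounds.
  move=> s1 [F1 e1]; have Es1 := env_frame F1 isT Es; have [_ a1 _] := F1.
  pose I j (s' : store) := [/\ env s', arr s' 0 = arr s 0, t0 = reg s' vt + j,
    t0 - n <= reg s' vt & tally (arr s' 2) (keys (t0 - n) (reg s' vt))].
  (* The truncated window before [t0] has [minn t0 n] elements. *)
  apply: (@tri_loop _ _ _ _ _ _ I _ _ (csize count_loop + tlocate) _ _ _ _ (minn t0 n)).
  - by [].
  - move=> j s' [Es' eA ej hlo hC]; have [_ e2 _ _] := Es'; rewrite /= e2 => hi.
    split; first by lia.
    apply: tri_le.
      apply: tri_seq; apply: tri_weak (tri_frame (@tri_wp _ _ _ _ _ _ _ s'
        (fun s'' => reg s'' vq = reg s' vt) _)) (leqnn _) _ => //.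
      move=> s2 [F2 e3]; have Es2 := env_frame F2 isT Es'; have [r2 a2 _] := F2.
      have eA2 : arr s2 0 = arr s 0 by rewrite a2.
      have hq : reg s2 vq < n.*2.-1 by lia.
      have hA2 : sorted_on kf (arr s2 0) 0 K by rewrite eA2.
      apply: tri_seq; apply: tri_weak (tri_frame (locate_spec Es2 hA2 hq)) (leqnn _) _.
      move=> s3 [F3 e4]; have Es3 := env_frame F3 isT Es2; have [r3 a3 _] := F3.
      have eA3 : arr s3 0 = arr s 0 by rewrite a3.
      have eq3 : reg s3 vq = reg s' vt by rewrite r3.
      have et3 : reg s3 vt = reg s' vt by rewrite r3 // r2.
      apply: tri_weak (tri_frame (@count_post_spec s3 (keys (t0 - n) (reg s' vt))
        (key (reg s' vt)) Es3 _ _ _ _ _ _ _)) (leqnn _) _.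
      - by rewrite eA3.
      - by rewrite eq3 -e3.
      - by rewrite eq3.
      - by rewrite e4 e3.
      - by rewrite a3 // a2.
      - by rewrite size_keys; lia.
      - by rewrite et3.
      move=> s4 [F4 [g1 g2 g3]]; split.
      - exact: env_frame F4 isT Es3.
      - by rewrite g3.
      - by rewrite g2 et3; lia.
      - by rewrite g2 et3; lia.
      by rewrite g2 et3 keys_rcons.
    by rewrite /count_loop /=; lia.
  - move=> j s' [[_ e2 _ _] eA ej hlo hC] /=; rewrite e2 => hn.
    have E : reg s' vt = t0 by lia.
    by rewrite E in hC.
  split; rewrite ?e1 ?a1 //; first by lia.
  move=> p hp; rewrite /keys /index_iota subnn /=; apply: h0.
  have /(@cls_found _ _ kf _ K (kf p) p hA hp)[] : kf p = kf p by [].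
  by [].
apply: leq_add; first exact: leq_addr.
by apply: leq_mul; [rewrite leq_add2r; exact: leq_addl|lia].
Qed.

Hypothesis word_pow : 2 * n.+1 ^ k.+1 < 2 ^ w.

Lemma pow_lt : n.+1 ^ k < 2 ^ w.
Proof. by apply: leq_ltn_trans word_pow; rewrite expnS mulnA leq_pmull. Qed.

(** This sum is the intermediate value of an update, before the subtraction. Both terms are at most
    [n.+1 ^ k.+1], whence the factor 2 in [word_pow]. *)
Lemma moment_pow_lt (a : seq D) v : size a <= n -> v <= n.+1 ->
  freq_moment k a + pw k v < 2 ^ w.
Proof.
move=> ha hv; apply: leq_ltn_trans word_pow; rewrite mul2n -addnn.
apply: leq_add.
  by apply: leq_trans (freq_moment_le _ _) _; rewrite leq_exp2r // ltnW.
by apply: leq_trans (pw_le _ hv) _; rewrite expnS leq_pmull.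
Qed.

Lemma depart_spec s a y p : sorted_on kf (arr s 0) 0 K ->
  p < K -> kf p = y -> reg s vlo = cls kf K y -> tally (arr s 2) (y :: a) ->
  reg s vF = freq_moment k (y :: a) -> size a < n ->
  tri (depart k) s (csize (depart k)) (fun s' =>
    [/\ tally (arr s' 2) a, reg s' vF = freq_moment k a & arr s' 0 = arr s 0]).
Proof.
move=> hA hp hy elo hC eF ha.
have [hc _] := cls_found hA hp hy.
have ev : arr s 2 (cls kf K y) = (count_mem y a).+1.
  by rewrite -{1}hy hC // hy /= eqxx.
have hv : count_mem y a <= size a := count_size _ _.
have hF := freq_moment_cons k y a.
set v := count_mem y a in ev hv hF *.
have hpow := pow_lt.
apply: tri_wp => /=; rewrite !eval_pwe /= elo ev eF subn1 /=.
have E : freq_moment k (y :: a) + pw k v - pw k v.+1 =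
         freq_moment k a by rewrite hF addnK.
have h1 : freq_moment k (y :: a) + pw k v < 2 ^ w.
  by apply: moment_pow_lt => /=; lia.
split; first by bounds.
rewrite E; split.
  split; [split=> //|by apply: (@safe_pwe _ _ _ _ _ n.+1) => //=; lia|by lia].
  by apply: (@safe_pwe _ _ _ _ _ n.+1) => //=; bounds.
split; [by []|by bounds|by lia|split=> //].
apply: (tally_update hC hp hy) => // z ne.
by rewrite /= eq_sym (negPf ne).
Qed.

Definition window t := keys (t - n) t.

(** The output after [t] steps: step [u] ends with the window before [u.+1], which is complete from
    [u.+1 = n] on. *)
Definition outs t := [seq freq_moment k (window u.+1) | u <- iota 0 t & n <= u.+1].

Lemma outsS t : outs t.+1 =
  if n <= t.+1 then rcons (outs t) (freq_moment k (window t.+1)) else outs t.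
Proof.
rewrite /outs -addn1 iotaD filter_cat map_cat /= add0n addn1.
by case: ifP => _ /=; rewrite ?cats1 ?cats0.
Qed.

Lemma step_post_spec s a y p : env s -> sorted_on kf (arr s 0) 0 K ->
  p < K -> kf p = y -> reg s vlo = cls kf K y -> tally (arr s 2) a ->
  reg s vF = freq_moment k a -> size a < n ->
  rcons a y = window (reg s vt).+1 -> log s = outs (reg s vt) ->
  reg s vt < n.*2.-1 ->
  tri (step_post k) s (csize (step_post k)) (fun s' =>
    [/\ tally (arr s' 2) (rcons a y), reg s' vF = freq_moment k (rcons a y),
        arr s' 0 = arr s 0, reg s' vt = (reg s vt).+1 &
        log s' = outs (reg s vt).+1]).
Proof.
move=> [en _ _ _] hA hp hy elo hC eF ha hw hlog ht.
have [hc _] := cls_found hA hp hy.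
have ev : arr s 2 (cls kf K y) = count_mem y a by rewrite -{1}hy hC // hy.
have hv : count_mem y a <= size a := count_size _ _.
have hF := freq_moment_rcons k y a.
set v := count_mem y a in ev hv hF *.
have hpow := pow_lt.
apply: tri_wp => /=; rewrite !eval_pwe /= elo ev eF en addn1.
have E : freq_moment k a + pw k v.+1 - pw k v =
         freq_moment k (rcons a y) by rewrite -hF addnK.
have h1 : freq_moment k a + pw k v.+1 < 2 ^ w.
  by apply: moment_pow_lt => /=; lia.
have hT : tally (fun i => if i == cls kf K y then v.+1 else arr s 2 i)
    (rcons a y).
  apply: (tally_update hC hp hy); first by rewrite count_mem_rcons eqxx addn1.
  by move=> z ne; rewrite count_mem_rcons eq_sym (negPf ne) addn0.
split; first by bounds.
rewrite E; split.
  split; [split=> //|by apply: (@safe_pwe _ _ _ _ _ n.+1) => //=; lia|by lia].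
  by apply: (@safe_pwe _ _ _ _ _ n.+1) => //=; bounds.
split; [by []|by bounds|by lia|split; first by bounds].
rewrite addn1; split; [by []| |] => hlt.
  by split=> //; rewrite outsS leqNgt hlt.
by split=> //; split=> //; rewrite outsS leqNgt hlt -hw hlog.
Qed.

Lemma kf_arrive t : t0 <= t < t0 + len -> kf (t - t0) = key t.
Proof. by move=> h; rewrite /kf divn_small; [congr key|]; lia. Qed.

Lemma kf_depart t : t0 <= t < t0 + len -> kf (len + (t - t0)) = key (t - n).
Proof.
move=> h; rewrite /kf -[X in (X + _) %/ len]mul1n divnMDl // divn_small; last by lia.
by congr key; lia.
Qed.

Notation tstep :=
  ((csize (step_loop k) + (csize (step_loop k) + (tlocate + tlocate))) * len.+1).

Lemma step_loop_spec s : env s -> sorted_on kf (arr s 0) 0 K ->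
  tally (arr s 2) (window t0) -> reg s vt = t0 ->
  reg s vF = freq_moment k (window t0) -> log s = outs t0 ->
  tri (step_loop k) s tstep (fun s' =>
    reg s' vF = freq_moment k (window (t0 + len)) /\ log s' = outs (t0 + len)).
Proof.
move=> Es hA hC et eF eL.
pose I j (s' : store) := [/\ env s', arr s' 0 = arr s 0, t0 + len = reg s' vt + j,
  t0 <= reg s' vt & [/\ tally (arr s' 2) (window (reg s' vt)),
  reg s' vF = freq_moment k (window (reg s' vt)) & log s' = outs (reg s' vt)]].
apply: (@tri_loop _ _ _ _ _ _ I).
- by move=> j s' [[_ e2 e3 _] _ _ _ _] /=; rewrite e2 e3; bounds.
- move=> j s' [Es' eA ej hlo [hC' eF' eL']]; have [en e2 e3 _] := Es'.
  rewrite /= e2 e3 => hi; split; first by lia.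
  set t := reg s' vt in ej hlo hC' eF' eL' hi *.
  have ht : t0 <= t < t0 + len by lia.
  have hA' : sorted_on kf (arr s' 0) 0 K by rewrite eA.
  apply: tri_le.
    apply: tri_seq.
    apply: (@tri_weak _ _ _ _ _ _ _ _ _ _
      (fun s1 => frame (If (CLt (V vt) (V vn)) Skip
           ((vq ::= V vt - V vn) ;; locate ;; depart k)) s' s1 /\
        [/\ tally (arr s1 2) (keys (t.+1 - n) t),
        reg s1 vF = freq_moment k (keys (t.+1 - n) t)
        & arr s1 0 = arr s 0])).
    - apply: tri_frame; apply: (@tri_if _ _ _ _ _ _ _ _ _ _
        (csize (vq ::= V vt - V vn) + (tlocate + csize (depart k)))); first by [].
      + rewrite /= en -/t => hlt; apply: (@tri_le _ _ _ _ _ _ _ _ 0) => //.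
        apply: tri_skip; rewrite /window in hC' eF'.
        (* For [t < n] both left ends truncate to 0, so skipping the departure leaves the same list
           as performing it does for [t >= n]. *)
        by have <- : t - n = t.+1 - n by lia.
      rewrite /= en -/t -leqNgt => hge.
      have hw : window t = key (t - n) :: keys (t.+1 - n) t.
        by rewrite /window keys_cons ?subSn //; lia.
      rewrite hw in hC' eF'.
      apply: tri_seq; apply: tri_weak (tri_frame (@tri_wp _ _ _ _ _ _ _ s'
        (fun s'' => reg s'' vq = t - n) _)) (leqnn _) _.
        by rewrite /= en -/t; bounds.
      move=> s2 [F2 eq2]; have Es2 := env_frame F2 isT Es'; have [r2 a2 _] := F2.
      have hA2 : sorted_on kf (arr s2 0) 0 K by rewrite a2.
      have hq2 : reg s2 vq < n.*2.-1 by lia.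
      apply: tri_seq; apply: tri_weak (tri_frame (locate_spec Es2 hA2 hq2)) (leqnn _) _.
      move=> s3 [F3 e4]; have [r3 a3 _] := F3.
      apply: tri_weak (@depart_spec s3 (keys (t.+1 - n) t) (key (t - n))
        (len + (t - t0)) _ _ _ _ _ _ _) (leqnn _) _.
      + by rewrite a3.
      + by lia.
      + exact: kf_depart.
      + by rewrite e4 eq2.
      + by rewrite a3 // a2.
      + by rewrite r3 // r2.
      + by rewrite size_keys; lia.
      by move=> s4 [g1 g2 g3]; split; rewrite // g3 a3 // a2.
    - exact: leqnn.
    move=> s1 [F1 [hC1 eF1 eA1]]; have Es1 := env_frame F1 isT Es'.
    have [r1 _ l1] := F1.
    have et1 : reg s1 vt = t by rewrite r1.
    have el1 : log s1 = outs t by rewrite l1.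
    apply: tri_seq; apply: tri_weak (tri_frame (@tri_wp _ _ _ _ _ _ _ s1
      (fun s'' => reg s'' vq = t) _)) (leqnn _) _.
      by rewrite /= et1; bounds.
    move=> s2 [F2 eq2]; have Es2 := env_frame F2 isT Es1; have [r2 a2 l2] := F2.
    have hA2 : sorted_on kf (arr s2 0) 0 K by rewrite a2 // eA1.
    have hq2 : reg s2 vq < n.*2.-1 by lia.
    apply: tri_seq; apply: tri_weak (tri_frame (locate_spec Es2 hA2 hq2)) (leqnn _) _.
    move=> s3 [F3 e4]; have Es3 := env_frame F3 isT Es2; have [r3 a3 l3] := F3.
    have et3 : reg s3 vt = t by rewrite r3 // r2.
    have hw : rcons (keys (t.+1 - n) t) (key t) = window t.+1.
      by rewrite /window keys_rcons //; lia.
    apply: tri_weak (tri_frame (@step_post_spec s3 (keys (t.+1 - n) t) (key t)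
      (t - t0) Es3 _ _ _ _ _ _ _ _ _ _)) (leqnn _) _.
    - by rewrite a3.
    - by lia.
    - exact: kf_arrive.
    - by rewrite e4 eq2.
    - by rewrite a3 // a2.
    - by rewrite r3 // r2.
    - by rewrite size_keys; lia.
    - by rewrite et3.
    - by rewrite l3 // l2 // el1 et3.
    - by rewrite et3; lia.
    rewrite et3 hw => s4 [F4 [g1 g2 g3 g4 g5]]; split.
    - exact: env_frame F4 isT Es3.
    - by rewrite g3 a3 // a2.
    - by rewrite g4; lia.
    - by rewrite g4; lia.
    by rewrite g4.
  by rewrite /step_loop /=; lia.
- move=> j s' [[_ e2 e3 _] _ ej hlo [_ h1 h2]] /=; rewrite e2 e3 => hn.
  have E : reg s' vt = t0 + len by lia.
  by rewrite E in h1 h2.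
by split; rewrite ?et.
Qed.

End Block.

(** * The whole run and its time *)

Section Main.

Variables (disp : Order.disp_t) (D : orderType disp).
Variables (x : seq D) (key : nat -> D) (w n ell k lam : nat).

Notation asz := (ell + ell).
Notation tri := (tri x key w asz).

Hypothesis n_gt0 : 0 < n.
Hypothesis size_x : size x = n.*2.-1.
Hypothesis word : 100 + 16 * (n + ell) < 2 ^ w.
Hypothesis word_pow : 2 * n.+1 ^ k.+1 < 2 ^ w.
Hypothesis ell_gt0 : 0 < ell.
Hypothesis ell_lam : ell + ell < 2 ^ lam.

(** A crude constant above every code size involved, depending on [k] only. It turns the nested time
    bounds into polynomials in a few variables. *)
Definition max_size := csize search + csize merge_pre + csize merge_mid +
  csize merge_post + csize merge_loop + csize copy_loop + csize level +
  csize fill_loop + csize sort_items + csize locate + csize count_loop +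
  csize (step_loop k) + csize block_pre + csize (block k) + csize lg_loop +
  csize setup_post + csize (prog k).

(** The product of [lam.+1 ^ 2] and the number of items pays for the sort, which performs binary
    searches on each of its levels; [lam.+1 * n.+1] pays for the scan of the window. *)
Definition block_time :=
  max_size * lam.+1 * (20 * lam.+1 * (ell + ell).+1 + 10 * n.+1).

Lemma block_time_ge len : len <= ell ->
  let tsearch := csize search * lam.+1 in
  let tmerge := csize merge_pre +
    (tsearch + (csize merge_mid + (tsearch + csize merge_post))) in
  let tlocate := csize locate + tsearch in
  let tlevel := csize level + ((csize merge_loop + tmerge) * (len + len).+1 +
    (csize copy_loop + csize copy_loop) * (len + len).+1) in
  csize block_pre +
  ((csize sort_items + ((csize fill_loop + csize fill_loop) * (len + len).+1 +
     (csize sort_items + tlevel) * lam.+1)) +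
   ((csize count_loop + (csize count_loop + (csize count_loop + tlocate)) * n.+1) +
    ((csize (step_loop k) + (csize (step_loop k) + (tlocate + tlocate))) * len.+1 +
     csize (block k)))) <= block_time.
Proof.
move=> hlen; cbv zeta; rewrite /block_time.
have hm : all (leq^~ max_size) [:: csize search; csize merge_pre; csize merge_mid;
    csize merge_post; csize merge_loop; csize copy_loop; csize level;
    csize fill_loop; csize sort_items; csize locate; csize count_loop;
    csize (step_loop k); csize block_pre; csize (block k)].
  rewrite /max_size; move: (csize search) (csize merge_pre) (csize merge_mid)
    (csize merge_post) (csize merge_loop) (csize copy_loop) (csize level)
    (csize fill_loop) (csize sort_items) (csize locate) (csize count_loop)
    (csize (step_loop k)) (csize block_pre) (csize (block k))
    => * /=; repeat (apply/andP; split); by lia.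
have hK : (len + len).+1 <= (ell + ell).+1 by lia.
have hL : len.+1 <= (ell + ell).+1 by lia.
move: hm hK hL; move: (csize search) (csize merge_pre) (csize merge_mid)
    (csize merge_post) (csize merge_loop) (csize copy_loop) (csize level)
    (csize fill_loop) (csize sort_items) (csize locate) (csize count_loop)
    (csize (step_loop k)) (csize block_pre) (csize (block k)) max_size
    (len + len).+1 len.+1 => a1 a2 a3 a4 a5 a6 a7 a8 a9 a10 a11 a12 a13 a14 M K L /=.
move=> /and5P[h1 h2 h3 h4 /and5P[h5 h6 h7 h8 /and5P[h9 h10 h11 h12 /and3P[h13 h14 _]]]].
have : 0 < (ell + ell).+1 by []. have : 0 < lam.+1 by []. have : 0 < n.+1 by [].
move: (ell + ell).+1 lam.+1 n.+1 => Kb l nn hn hl hb hK hL.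
apply: (@leq_trans (M + ((M + ((M + M) * Kb + (M + (M + ((M + (M + (M * l +
   (M + (M * l + M))))) * Kb + (M + M) * Kb))) * l)) +
   ((M + (M + (M + (M + M * l))) * nn) +
   ((M + (M + ((M + M * l) + (M + M * l)))) * Kb + M))))).
  by repeat first [apply: leq_add | apply: leq_mul].
(* Every monomial is at most [M * l * l * Kb] or [M * l * nn]; the coefficients 20 and 10 leave room
   for their number. *)
have e1 : M <= M * l by rewrite leq_pmulr.
have e2 : M * l <= M * l * Kb by rewrite leq_pmulr.
have e3 : M * l * Kb <= M * l * Kb * l by rewrite leq_pmulr.
have e4 : M * Kb <= M * Kb * l by rewrite leq_pmulr.
have e5 : M * nn <= M * nn * l by rewrite leq_pmulr.
have e6 : M * l <= M * l * nn by rewrite leq_pmulr.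
by lia.
Qed.

Definition main_env s t0 :=
  [/\ reg s vn = n, reg s vell = ell & reg s vN = n.*2.-1] /\
  [/\ reg s vt0 = t0, reg s vF = freq_moment k (window key n t0)
    & log s = outs key n k t0].

Lemma block_spec s t0 : main_env s t0 -> t0 < n.*2.-1 ->
  tri (block k) s block_time (fun s' => main_env s' (minn (t0 + ell) n.*2.-1)).
Proof.
move=> [[en el eN] [et eF eL]] ht; set len := minn ell (n.*2.-1 - t0).
have len_le : len <= ell by lia.
have len_gt0 : 0 < len by lia.
have end_le : t0 + len <= n.*2.-1 by lia.
have K_lt : len + len < 2 ^ lam by apply: leq_ltn_trans ell_lam; lia.
apply: tri_le (block_time_ge len_le); rewrite /block.
apply: tri_seq; apply: tri_weak (tri_frame (@tri_wp _ _ _ _ _ _ _ s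
  (fun s' => reg s' vlen = len /\ reg s' vK = len + len) _)) (leqnn _) _.
  rewrite /= eN et el; split; first by bounds.
  by split; [by []|move=> h|move=> h]; bounds.
move=> s1 [F1 [e1 e2]]; have [r1 a1 l1] := F1.
have Es1 : env n t0 len s1 by split; rewrite // r1.
apply: tri_seq; apply: tri_weak (tri_frame (sort_spec key n_gt0 size_x word
  len_gt0 len_le end_le K_lt Es1)) (leqnn _) _.
move=> s2 [F2 [hA h0]]; have Es2 := env_frame F2 isT Es1; have [r2 a2 l2] := F2.
apply: tri_seq; apply: tri_weak (tri_frame (count_loop_spec n_gt0 size_x word
  len_gt0 len_le end_le K_lt Es2 hA h0)) (leqnn _) _.
move=> s3 [F3 [hC eA ev]]; have Es3 := env_frame F3 isT Es2; have [r3 a3 l3] := F3.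
have hA3 : sorted_on (kf key n t0 len) (arr s3 0) 0 (len + len) by rewrite eA.
have eF3 : reg s3 vF = freq_moment k (window key n t0) by rewrite r3 // r2 // r1.
have eL3 : log s3 = outs key n k t0 by rewrite l3 // l2 // l1.
apply: tri_seq; apply: tri_weak (tri_frame (step_loop_spec n_gt0 size_x word
  len_gt0 len_le end_le K_lt word_pow Es3 hA3 hC ev eF3 eL3)) (leqnn _) _.
move=> s4 [F4 [gF gL]]; have [en4 et4 el4 _] := env_frame F4 isT Es3.
have [r4 _ _] := F4.
apply: (@tri_le _ _ _ _ _ _ _ _ (csize (vt0 ::= V vt0 + V vlen)) _ _ _); last first.
  by rewrite /block /=; lia.
apply: tri_wp; rewrite /= et4 el4; split; first by bounds.
have -> : minn (t0 + ell) n.*2.-1 = t0 + len by lia.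
split; split=> //=.
- by rewrite r4 // r3 // r2 // r1.
- by rewrite r4 // r3 // r2 // r1.
Qed.

Variable S : nat.
Hypothesis S_lt : S < 2 ^ w.
Hypothesis ellE : ell = (S %/ lg n).+1.

Definition prog_time := csize (prog k) +
  ((csize lg_loop + csize lg_loop) * (lg n).+1 + (csize (prog k) +
   (csize (prog k) + block_time) * (n.*2.-1 %/ ell).+2)).

Lemma lg_loop_spec s : reg s vn = n -> reg s vlg = 0 -> reg s vpow = 1 ->
  tri lg_loop s ((csize lg_loop + csize lg_loop) * (lg n).+1)
    (fun s' => reg s' vlg = lg n).
Proof.
move=> en el ep.
have n_le : n <= 2 ^ lg n by apply: up_logP.
pose I j (s' : store) := [/\ reg s' vn = n, reg s' vlg + j = lg n &
  reg s' vpow = 2 ^ reg s' vlg].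
apply: (@tri_loop _ _ _ _ _ _ I); first by [].
- move=> j s' [en' ej ep'] /=; rewrite en' => hlt.
  have hj : 0 < j.
    rewrite lt0n; apply/eqP => j0; rewrite j0 addn0 in ej.
    by rewrite ep' ej ltnNge n_le in hlt.
  split=> //; apply: tri_le; [apply: tri_wp|by []].
  have hl : reg s' vlg < n.
    by apply: leq_ltn_trans hlt; rewrite ep' ltnW // ltn_expl.
  rewrite /=; split; first by bounds.
  split; first by bounds.
  by split=> //=; [lia|rewrite ep' addn1 expnS; lia].
- move=> j s' [en' ej ep'] /=; rewrite en' -leqNgt ep' => hge.
  have : lg n <= reg s' vlg by apply: up_log_min.
  by lia.
by split; rewrite ?el ?ep.
Qed.

Lemma prog_spec s : (forall y, reg s y = if y == vn then n else if y == vS then S else 0) ->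
  log s = [::] ->
  tri (prog k) s prog_time (fun s' => log s' = outs key n k n.*2.-1).
Proof.
move=> hs hlog; rewrite /prog_time.
apply: (@tri_le _ _ _ _ _ _ _ _ (csize (vpow ::= N 1) +
  ((csize lg_loop + csize lg_loop) * (lg n).+1 + (csize setup_post +
   (csize (While (CLt (V vt0) (V vN)) (block k)) + block_time) *
     (n.*2.-1 %/ ell).+2)))); last first.
  have -> : csize (prog k) = csize (vpow ::= N 1) + (csize lg_loop +
     (csize setup_post + csize (While (CLt (V vt0) (V vN)) (block k)))) by [].
  move: (csize (vpow ::= N 1)) (csize lg_loop) (csize setup_post)
    (csize (While _ _)) => a b c d.
  by apply: leq_add; [lia|apply: leq_add => //; apply: leq_add; [lia|
    apply: leq_mul => //; lia]].
apply: tri_seq; apply: tri_weak (tri_frame (@tri_wp _ _ _ _ _ _ _ s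
  (fun s' => reg s' vpow = 1) _)) (leqnn _) _; first by rewrite /=; bounds.
move=> s1 [F1 e1]; have [r1 _ l1] := F1.
apply: tri_seq; apply: tri_weak (tri_frame (@lg_loop_spec s1 _ _ e1)) (leqnn _) _.
- by rewrite r1 // hs.
- by rewrite r1 // hs.
move=> s2 [F2 e2]; have [r2 _ l2] := F2.
have en2 : reg s2 vn = n by rewrite r2 // r1 // hs.
have eS2 : reg s2 vS = S by rewrite r2 // r1 // hs.
apply: tri_seq; apply: tri_weak (tri_frame (@tri_wp _ _ _ _ _ _ _ s2
  (fun s' => reg s' vell = ell /\ reg s' vN = n.*2.-1) _)) (leqnn _) _.
  rewrite /= e2 en2 eS2 addn1 -ellE; have := leq_div S (lg n).
  by split; [bounds|split; [bounds|split=> //; lia]].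
move=> s3 [F3 [e3 e4]]; have [r3 _ l3] := F3.
pose I j (s' : store) := exists t0, [/\ main_env s' t0, t0 <= n.*2.-1
  & n.*2.-1 <= t0 + j * ell].
apply: (@tri_loop _ _ _ _ _ _ I).
- by [].
- move=> j s' [t0 [Es' h1 h2]]; have [[_ _ eN] [et _ _]] := Es'.
  rewrite /= eN et => hlt; split; first by case: j h2; rewrite // mul0n; lia.
  apply: tri_weak (block_spec Es' hlt) (leqnn _) _ => s4 Es4.
  exists (minn (t0 + ell) n.*2.-1); split=> //; first by lia.
  by case: j h2 => [|j] /=; rewrite ?mulSn; lia.
- move=> j s' [t0 [[[_ _ eN] [et _ eL]] h1 h2]] /=; rewrite eN et => hge.
  by rewrite eL; congr (outs _ _ _ _); lia.
exists 0; split; [split; split=> //|by []|].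
- by rewrite r3.
- by rewrite r3 // r2 // r1 // hs.
- rewrite r3 // r2 // r1 // hs.
  by rewrite /window /keys sub0n /index_iota /= /freq_moment big_nil.
- by rewrite l3 // l2 // l1.
(* The number of blocks is at most [(n.*2.-1 %/ ell).+1], the last one possibly shorter; the other
   successor in the time bound is that of [tri_loop]. *)
by have := ltn_ceil n.*2.-1 ell_gt0; lia.
Qed.

End Main.

(** * Resource bounds *)

Lemma sliding_outs (disp : Order.disp_t) (D : orderType disp) (k n : nat)
    (x : (n.*2.-1).-tuple D) (d : D) : 0 < n ->
  outs (nth d x) n k n.*2.-1 = sliding (freq_moment k) x :> seq nat.
Proof.
move=> n_gt0; rewrite /outs.
have -> : iota 0 n.*2.-1 = iota 0 n.-1 ++ iota n.-1 n.
  have -> : n.*2.-1 = n.-1 + n by lia.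
  by rewrite iotaD.
rewrite filter_cat map_cat.
have -> : [seq u <- iota 0 n.-1 | n <= u.+1] = [::].
  apply/eqP; rewrite -(negbK (_ == _)) -has_filter; apply/hasPn => u.
  by rewrite mem_iota; lia.
have -> : [seq u <- iota n.-1 n | n <= u.+1] = iota n.-1 n.
  by apply/all_filterP/allP => u; rewrite mem_iota; lia.
apply: (@eq_from_nth _ 0) => [|i]; first by rewrite size_map size_iota size_tuple.
rewrite size_map size_iota => hi.
rewrite (nth_map 0) ?size_iota // nth_iota //.
rewrite -[i in RHS]/(val (Ordinal hi)) -tnth_nth tnth_mktuple /=.
congr freq_moment; have -> : (n.-1 + i).+1 = i + n by lia.
rewrite /window addnK; apply: (@eq_from_nth _ d).
  by rewrite size_keys size_takel ?size_drop ?size_tuple; lia.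
move=> j; rewrite size_keys => hj.
rewrite (nth_map 0) ?size_iota // nth_iota // nth_take ?nth_drop //; lia.
Qed.

(** [vn] and [vS] are numbered 0 and 1 because [init] puts the parameters there. The program relies
    on the zeros elsewhere as initial values of [vlg], [vt0] and [vF]. *)
Lemma rep_init m n S w asz : m = nreg + 3 * asz -> n < 2 ^ w -> S < 2 ^ w ->
  rep w asz 0 (Store_ (fun y => if y == vn then n else if y == vS then S else 0)
    (fun _ _ => 0) [::]) (init m n S).
Proof.
move=> hm hn hS; have h0 : 0 < 2 ^ w by rewrite expn_gt0.
have E a : nth 0 (memory (init m n S)) a =
    if a == vn then n else if a == vS then S else 0.
  by case: a => [|[|a]] //=; rewrite nth_nseq if_same.
split=> //; first by rewrite /= size_nseq hm.
split=> [i j _ _|a]; last by rewrite E; case: a => [|[|a]].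
by rewrite E /nreg.
Qed.

Section Bounds.

Variables (k n S : nat).

(** The successor gives [S <= ell * lg n] for the time bound. It also keeps blocks nonempty for
    [n = 1], where [lg n = 0] and the quotient by 0 is 0. *)
Definition ell := (S %/ lg n).+1.
Definition lam := lg n + 3.
(** The 9 bits absorb the constants of [word_ell], and [k.+1] fields of [(lg n).+1] bits hold
    [n.+1 ^ k.+1], since [n.+1 <= 2 ^ (lg n).+1]. *)
Definition word_size := 9 + k.+2 * (lg n).+1.
Definition factor := 45 * (2 * k + 13) + 160 * 100 * max_size k.

Hypothesis n_gt0 : 0 < n.
Hypothesis S_le : lg n <= S <= n.

Lemma n_le : n <= 2 ^ lg n.
Proof. exact: up_logP. Qed.

Lemma ell_le : ell <= n.+1.
Proof. by rewrite /ell ltnS; have := leq_div S (lg n); lia. Qed.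

Lemma ell_lam : ell + ell < 2 ^ lam.
Proof. by rewrite /lam expnD; have := n_le; have := ell_le; lia. Qed.

Lemma word_ell : 100 + 16 * (n + ell) < 2 ^ word_size.
Proof.
have h : 2 ^ (9 + (lg n).+1) <= 2 ^ word_size.
  by rewrite leq_exp2l // leq_add2l leq_pmull.
apply: leq_trans h; rewrite expnD (expnS 2 (lg n)).
by have := n_le; have := ell_le; lia.
Qed.

Lemma word_pow : 2 * n.+1 ^ k.+1 < 2 ^ word_size.
Proof.
have h : n.+1 <= 2 ^ (lg n).+1 by rewrite expnS; have := n_le; lia.
apply: (@leq_ltn_trans (2 ^ (1 + k.+1 * (lg n).+1))).
  by rewrite expnD leq_mul2l mulnC expnM leq_exp2r.
by rewrite ltn_exp2l // /word_size; lia.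
Qed.

Hypothesis n_gt1 : 1 < n.

Lemma lg_gt0 : 0 < lg n.
Proof. by rewrite up_log_gt0. Qed.

Lemma ell_lg_le : ell * lg n <= 2 * S.
Proof. by rewrite /ell mulSn; have := leq_divM S (lg n); lia. Qed.

Lemma word_size_le : word_size <= (2 * k + 13) * lg n.
Proof. by rewrite /word_size; have := lg_gt0; nia. Qed.

(** The 33 registers cost [33 * lg n <= 33 * S] and the arrays [6 * (ell * lg n) <= 12 * S], up to
    the factor [2 * k + 13]; together this is 45. *)
Lemma space_le : (nreg + 3 * (ell + ell)) * word_size <= 45 * (2 * k + 13) * S.
Proof.
apply: (@leq_trans ((nreg + 3 * (ell + ell)) * ((2 * k + 13) * lg n))).
  by rewrite leq_mul2l word_size_le orbT.
have -> : (nreg + 3 * (ell + ell)) * ((2 * k + 13) * lg n) =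
          (2 * k + 13) * (33 * lg n + 6 * (ell * lg n)) by rewrite /nreg; lia.
rewrite [45 * _]mulnC -mulnA leq_mul2l; apply/orP; right.
by have := ell_lg_le; lia.
Qed.

Lemma time_le : prog_time n ell k lam * S <= 160 * 100 * max_size k * (n ^ 2 * lg n ^ 2).
Proof.
have hL := lg_gt0; have hn := n_le; have hel := ell_lg_le; have hle := ell_le.
set L := lg n in hL hel *; set M := max_size k.
have hS : S <= ell * L by rewrite ltnW // /ell ltn_ceil.
have hSn : S <= n by lia.
have hLS : L <= S by lia.
have hb : block_time n ell k lam <= M * (5 * L) * (520 * n).
  rewrite /block_time -/M; apply: leq_mul.
    by rewrite leq_mul2l; apply/orP; right; rewrite /lam -/L; lia.
  (* From [lam.+1 <= 5 * L], [ell * L <= 2 * S] and [L <= S <= n]. Then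
     [20 * 25 * n + 10 * n.+1 <= 520 * n]. *)
  have : lam.+1 * (ell + ell).+1 <= 25 * n.
    have : lam.+1 <= 5 * L by rewrite /lam -/L; lia.
    by move=> h; have := leq_mul h (leqnn (ell + ell).+1); lia.
  by rewrite -mulnA; lia.
have hM1 : csize (prog k) <= M by rewrite /M /max_size leq_addl.
have hM2 : csize lg_loop <= M by rewrite /M /max_size; lia.
have hq : (n.*2.-1 %/ ell).+2 * ell <= 6 * n.
  by rewrite !mulSn; have := leq_divM n.*2.-1 ell; lia.
rewrite /prog_time -/L.
set q := _.+2 in hq *.
apply: (@leq_trans ((M + ((M + M) * L.+1 + (M + (M + M * (5 * L) * (520 * n)) * q))) * S)).
  rewrite leq_mul2r; apply/orP; right; apply: leq_add => //.
  apply: leq_add; first by rewrite leq_mul2r leq_add // orbT.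
  by apply: leq_add => //; rewrite leq_mul2r leq_add // orbT.
have hML : M <= M * L by rewrite leq_pmulr.
have h1 : M + M * (5 * L) * (520 * n) <= 2601 * (M * L * n).
  have : M * L <= M * L * n by rewrite leq_pmulr.
  by lia.
have h2 : (M + (M + M) * L.+1 + M) * S <= 6 * (M * L * n).
  have h : M + (M + M) * L.+1 + M <= 6 * (M * L) by lia.
  by have := leq_mul h hSn; lia.
(* The trade-off: the number of blocks [q] is of order [n / ell], and [S <= ell * L], so [ell]
   cancels in [q * S]. With [h2] the total is [6 * 2601 + 6], below [160 * 100]. *)
have h3 : 2601 * (M * L * n) * q * S <= 6 * 2601 * (M * L * n * (n * L)).
  have := leq_mul (leqnn (2601 * (M * L * n) * q)) hS.
  have := leq_mul (leqnn (2601 * (M * L * n) * L)) hq.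
  by lia.
have h4 : M * L * n <= M * L * n * (n * L) by rewrite leq_pmulr // muln_gt0; lia.
have h5 := leq_mul (leq_mul h1 (leqnn q)) (leqnn S).
by lia.
Qed.

End Bounds.

Theorem theorem15 (k : nat) :
  exists (P : program) (c : nat),
    forall n S : nat, 0 < n -> lg n <= S <= n ->
    exists m w T : nat,
      (1 < n -> [/\ w <= c * lg n,
                    m * w <= c * S &
                    T * S <= c * (n ^ 2 * lg n ^ 2)]) /\
      (forall (disp : Order.disp_t) (D : orderType disp)
              (x : (n.*2.-1).-tuple D),
         computes P m w T n S x (sliding (freq_moment k) x)).
Proof.
exists (compile 0 (prog k)), (factor k) => n S n_gt0 S_le.
exists (nreg + 3 * (ell n S + ell n S)), (word_size k n),
  (prog_time n (ell n S) k (lam n)); split=> [n_gt1|disp D x].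
  split.
  - apply: leq_trans (word_size_le k n_gt0 S_le n_gt1) _.
    by rewrite leq_mul2r; apply/orP; right; rewrite /factor; lia.
  - apply: leq_trans (space_le k n_gt0 S_le n_gt1) _.
    by rewrite leq_mul2r leq_addr orbT.
  apply: leq_trans (time_le k n_gt0 S_le n_gt1) _.
  by rewrite leq_mul2r leq_addl orbT.
have hw := word_ell k n_gt0 S_le; have hp := word_pow k n_gt0 S_le.
set w := word_size k n in hw hp *.
have hn : n < 2 ^ w by lia.
have hS : S < 2 ^ w by lia.
split=> //.
have i0 : 0 < n.*2.-1 by lia.
(* [D] may be empty in general; as [n > 0], the first input element is available as a default for
   [nth]. *)
pose d := tnth x (Ordinal i0).
have szx : size x = n.*2.-1 by rewrite size_tuple.
have keyP i : i < size x -> onth x i = Some (nth d x i).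
  by rewrite -onthTE; case E: (onth x i) => [v|] // _; rewrite (onth_nth _ _ _ _ E).
have [s' [t [He Ht Hl]]] := @prog_spec _ D x (nth d x) w n (ell n S) k (lam n) n_gt0
  szx hw hp isT (ell_lam n_gt0 S_le) S hS erefl
  (Store_ (fun y => if y == vn then n else if y == vS then S else 0)
     (fun _ _ => 0) [::]) (fun=> erefl) erefl.
have fits : nreg + 3 * (ell n S + ell n S) <= 2 ^ w by rewrite /nreg; lia.
have [q [Hs [Hpc Ho _ _ _]]] := run_com keyP fits He
  (P := compile 0 (prog k)) (fun _ _ => erefl) (ok_prog k) (rep_init erefl hn hS).
exists t, q; split=> //; first by rewrite Hpc size_compile.
by rewrite Ho Hl sliding_outs.
Qed.
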